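(* Let $A$ be a skew-symmetrizable integral $m\times n$ matrix such that the cluster algebra $\mathcal{C}=\mathcal{C}(A)$ is acyclic. Then the Weil-Petersson form $\omega$ is a regular Kähler 2-form on $\mathcal{C}$.
   Context: Skew-symmetrizable matrices. Let $m\le n$. An integral $m\times n$ matrix $A$ is skew-symmetrizable if there is an integral diagonal $m\times m$ matrix $D$ with positive diagonal entries such that the restriction of $DA$ to the first $m$ columns is skew-symmetric. Seeds and mutation. A seed is a pair $(B,\mathbf{f})$ of a skew-symmetrizable $m\times n$ matrix $B$ and a set of variables $\mathbf{f}=\{f_1,\dots,f_n\}$. For $k\in\{1,\dots,m\}$ its mutation at $k$ is the seed $(\mu_k(B),\mu_k(\mathbf{f}))$ with $\mu_k(B)_{ij}=-B_{ij}$ if $k=i$ or $k=j$, and $\mu_k(B)_{ij}=B_{ij}+\tfrac12(|B_{ik}|B_{kj}+B_{ik}|B_{kj}|)$ otherwise; and $\mu_k(f_i)=f_i$ for $i\ne k$, $\mu_k(f_k)=f_k^{-1}\bigl(\prod_{j:B_{kj}>0}f_j^{B_{kj}}+\prod_{j:B_{kj}<0}f_j^{-B_{kj}}\bigr)$ (empty products are $1$). Cluster algebra. The initial seed is $(A,\mathbf{x})$ with $\mathbf{x}=\{x_1,\dots,x_n\}$ algebraically independent over $\mathbb{C}$. Seeds obtained from it by finite sequences of mutations are called equivalent to $(A,\mathbf{x})$; their matrices are called equivalent to $A$, their sets $\mathbf{f}$ are the clusters, and elements of clusters are cluster variables. The variables $x_{m+1},\dots,x_n$ are frozen and lie in every cluster.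 The cluster algebra $\mathcal{C}(A)$ is the $\mathbb{C}$-subalgebra of $\mathbb{C}(x_1,\dots,x_n)$ generated by all cluster variables together with $x_{m+1}^{-1},\dots,x_n^{-1}$. Acyclicity. A directed cycle of a skew-symmetrizable matrix $B$ is a sequence of indices $i_1,\dots,i_j\in\{1,\dots,m\}$, $j\ge2$, with $i_j=i_1$ and $B_{i_ki_{k+1}}>0$ for all $1\le k<j$. $B$ is acyclic if it has no directed cycles. $\mathcal{C}(A)$ is acyclic if some matrix equivalent to $A$ is acyclic. Kähler forms. For a commutative $\mathbb{C}$-algebra $R$, $\Omega(R)$ is the $R$-module of Kähler differentials over $\mathbb{C}$ and $\Omega^i(R)=\wedge^i_R\Omega(R)$ is the module of (regular) Kähler $i$-forms. If $R$ is a domain with fraction field $K$, elements of $\Omega^i(K)=K\otimes_R\Omega^i(R)$ are rational Kähler $i$-forms on $R$; such a form is regular if it lies in the image of $\Omega^i(R)$. Weil-Petersson form. For a seed $(B,\mathbf{f})$ equivalent to $(A,\mathbf{x})$ put $$\omega_{\mathbf{f}}=\sum_{i,j}\frac{B_{ij}}{f_if_j}\,df_i\wedge df_j,$$ the sum taken over the pairs $1\le i\le m$, $i<j\le n$; this is a rational Kähler 2-form on $\mathcal{C}(A)$. By a result quoted from Gekhtman-Shapiro-Vainshtein, $\omega_{\mathbf{f}}$ and $\omega_{\mathbf{f}'}$ agree for any two clusters $\mathbf{f},\mathbf{f}'$, so $\omega:=\omega_{\mathbf{f}}$ is taken as a rational Kähler 2-form on $\mathcal{C}(A)$ independent of the choice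 of cluster. It is called the Weil-Petersson form.
   Formalization: The forms ω_f need not agree between clusters and can fail to be regular if A is not skew-symmetric; so regularity is proved for ω when all ω_f agree, and for every seed for the form with DB in place of B (D any symmetrizer), which is ω_f itself when D = 1. *)

(* Defs.v *)
From HB Require Import structures.
From mathcomp Require Import all_boot all_order all_algebra.
From mathcomp Require Import generic_quotient ring_quotient fraction.
From mathcomp Require Import boolp.
From mathcomp Require Import freeg mpoly.

Set Implicit Arguments.
Unset Strict Implicit.
Unset Printing Implicit Defensive.

Import GRing.Theory.
Local Open Scope ring_scope.
Local Open Scope quotient_scope.

(* * Modules by generators and relations *)

Section ModuleQuotient.
Variables (R : nzRingType) (V : lmodType R).

Inductive in_span (rel : V -> Prop) : V -> Prop :=
| in_span0 : in_span rel 0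
| in_spanS a u v : rel u -> in_span rel v -> in_span rel (a *: u + v).

Lemma in_spanP rel a u v :
  in_span rel u -> in_span rel v -> in_span rel (a *: u + v).
Proof.
move=> + sv; elim=> [|b w x rw _ IH]; first by rewrite scaler0 add0r.
by rewrite scalerDr scalerA -addrA; apply: in_spanS.
Qed.

Lemma in_span_rel (rel : V -> Prop) u : rel u -> in_span rel u.
Proof.
by move=> ru; rewrite -[u]scale1r -[_ *: _]addr0; apply/in_spanS/in_span0.
Qed.

Definition span_pred (rel : V -> Prop) : {pred V} := fun v => `[< in_span rel v >].

Lemma span_pred_zmod_closed rel : zmod_closed (span_pred rel).
Proof.
split; first by apply/asboolP; apply: in_span0.
move=> u v /asboolP su /asboolP sv; apply/asboolP.
by rewrite addrC -scaleN1r; apply: in_spanP.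
Qed.

HB.instance Definition _ rel :=
  GRing.isZmodClosed.Build V (span_pred rel) (span_pred_zmod_closed rel).

(* [V] modulo the submodule generated by [rel]. *)
Definition lquot (rel : V -> Prop) := @Quotient.quot V (span_pred rel).

HB.instance Definition _ rel := GRing.Zmodule.on (lquot rel).

Definition lquot_pi rel (v : V) : lquot rel := \pi v.

Lemma lquot_pi_eq rel u v :
  lquot_pi rel u = lquot_pi rel v <-> in_span rel (u - v).
Proof.
rewrite /lquot_pi; split.
  by move=> /eqP; rewrite -Quotient.idealrBE => /asboolP.
by move=> h; apply/eqP; rewrite -Quotient.idealrBE; apply/asboolP.
Qed.

Lemma lquot_piD rel u v :
  lquot_pi rel (u + v) = lquot_pi rel u + lquot_pi rel v.
Proof. by rewrite /lquot_pi [RHS]piE. Qed.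

Lemma lquot_piK rel (w : lquot rel) : lquot_pi rel (repr w) = w.
Proof. exact: reprK. Qed.

Definition lquot_scale rel (a : R) (w : lquot rel) : lquot rel :=
  lquot_pi rel (a *: repr w).

Lemma lquot_scaleE rel a v :
  lquot_scale a (lquot_pi rel v) = lquot_pi rel (a *: v).
Proof.
apply/lquot_pi_eq; rewrite -scalerBr -[_ *: _]addr0; apply: in_spanP.
  by apply/lquot_pi_eq; rewrite lquot_piK.
exact: in_span0.
Qed.

Lemma lquot_scaleA rel a b (w : lquot rel) :
  lquot_scale a (lquot_scale b w) = lquot_scale (a * b) w.
Proof. by rewrite -[w]lquot_piK !lquot_scaleE scalerA. Qed.

Lemma lquot_scale1 rel : left_id 1 (@lquot_scale rel).
Proof. by move=> w; rewrite -[w]lquot_piK lquot_scaleE scale1r. Qed.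

Lemma lquot_scaleDr rel : right_distributive (@lquot_scale rel) +%R.
Proof.
move=> a u v; rewrite -[u]lquot_piK -[v]lquot_piK -lquot_piD.
by rewrite !lquot_scaleE scalerDr lquot_piD.
Qed.

Lemma lquot_scaleDl rel (w : lquot rel) :
  {morph (@lquot_scale rel)^~ w : a b / a + b}.
Proof.
by move=> a b; rewrite -[w]lquot_piK !lquot_scaleE scalerDl lquot_piD.
Qed.

HB.instance Definition _ rel :=
  GRing.Zmodule_isLmodule.Build R (lquot rel)
    (@lquot_scaleA rel) (@lquot_scale1 rel) (@lquot_scaleDr rel)
    (@lquot_scaleDl rel).

Lemma lquot_pi_linear rel : linear (lquot_pi rel).
Proof. by move=> a u v; rewrite lquot_piD -lquot_scaleE. Qed.

HB.instance Definition _ rel :=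
  GRing.isLinear.Build R V (lquot rel) _ (lquot_pi rel) (lquot_pi_linear rel).

(* Meaningful only when [g] vanishes on [rel], see [lquot_liftE]. *)
Definition lquot_lift rel (N : lmodType R) (g : V -> N) (w : lquot rel) : N :=
  g (repr w).

Lemma lquot_liftE rel (N : lmodType R) (g : {linear V -> N}) v :
  (forall u, rel u -> g u = 0) -> lquot_lift g (lquot_pi rel v) = g v.
Proof.
move=> g0; apply/eqP; rewrite -subr_eq0 -linearB /=; apply/eqP.
have: in_span rel (repr (lquot_pi rel v) - v).
  by apply/lquot_pi_eq; rewrite lquot_piK.
elim=> [|a u x ru _ IH]; first by rewrite linear0.
by rewrite linearP g0 // IH scaler0 addr0.
Qed.

Lemma lquot_lift_linear rel (N : lmodType R) (g : {linear V -> N}) :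
  (forall u, rel u -> g u = 0) -> linear (lquot_lift (rel := rel) g).
Proof.
move=> g0 a u v; rewrite -[u]lquot_piK -[v]lquot_piK -linearP.
by rewrite !lquot_liftE // linearP.
Qed.

End ModuleQuotient.

(* Linear extension of [f] to the free module on [T]. *)
Section FreeLift.
Variables (R : nzRingType) (T : choiceType) (M : lmodType R) (f : T -> M).

Lemma fglift_linear : linear (fglift f : {freeg T / R} -> M).
Proof.
have fgB u v : fglift f (u - v) = fglift f u - fglift f v.
  exact: lift_is_additive.
have fg0 : fglift f 0 = 0 by rewrite -(subrr 0) fgB subrr.
have fgN u : fglift f (- u) = - fglift f u by rewrite -sub0r fgB fg0 sub0r.
have fgD u v : fglift f (u + v) = fglift f u + fglift f v.
  by rewrite -[v]opprK fgB fgN !opprK.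
have fgS (I : Type) (r : seq I) (G : I -> {freeg T / R}) :
    fglift f (\sum_(i <- r) G i) = \sum_(i <- r) fglift f (G i).
  by elim/big_rec2: _ => [//|i x y _ <-]; rewrite fgD.
move=> a u v; rewrite fgD; congr (_ + _).
rewrite -[u in RHS]freeg_sumE fgS scaler_sumr.
rewrite -[u in LHS]freeg_sumE scaler_sumr fgS.
apply: eq_bigr => x _; set c := coeff x u.
have ->: a *: << c *g x >> = << a * c *g x >> :> {freeg T / R}.
  by apply/eqP/freeg_eqP => y; rewrite coeffZ !coeffU mulrA.
by rewrite !liftU scalerA.
Qed.

HB.instance Definition _ :=
  GRing.isLinear.Build R {freeg T / R} M _ (fglift f) fglift_linear.

Lemma fglift1 x : fglift f << x >> = f x.
Proof. by rewrite liftU scale1r. Qed.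

Lemma fgliftB (u v : {freeg T / R}) : fglift f (u - v) = fglift f u - fglift f v.
Proof. exact: (linearB (fglift f)). Qed.

Lemma fgliftZ a (u : {freeg T / R}) : fglift f (a *: u) = a *: fglift f u.
Proof. exact: (linearZ_LR (fglift f)). Qed.

End FreeLift.

(* * Kähler differentials

   [kaehler iota] is the module of Kähler differentials of [A] relative to the
   structure map [iota : k -> A]: the free module on the symbols d a modulo
   additivity, the Leibniz rule and d (iota c) = 0.  For commutative [A] this
   is the usual module; commutativity is not needed to write it down. *)

Section Kaehler.
Variables (k : Type) (A : nzRingType) (iota : k -> A).

Variant kaehler_rel : {freeg A / A} -> Prop :=
| KaehlerD a b : kaehler_rel (<< a + b >> - << a >> - << b >>)
| KaehlerM a b : kaehler_rel (<< a * b >> - a *: << b >> - b *: << a >>)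
| KaehlerC c : kaehler_rel << iota c >>.

Definition kaehler := lquot kaehler_rel.
HB.instance Definition _ := GRing.Lmodule.on kaehler.

Definition kd (a : A) : kaehler := lquot_pi kaehler_rel << a >>.

Lemma kdD a b : kd (a + b) = kd a + kd b.
Proof.
apply/eqP; rewrite -subr_eq0 opprD addrA -!raddfB /=; apply/eqP.
rewrite -(linear0 (lquot_pi kaehler_rel)); apply/lquot_pi_eq; rewrite subr0.
exact/in_span_rel/KaehlerD.
Qed.

Lemma kdM a b : kd (a * b) = a *: kd b + b *: kd a.
Proof.
apply/eqP; rewrite -subr_eq0 opprD addrA -!linearZ -!raddfB /=; apply/eqP.
rewrite -(linear0 (lquot_pi kaehler_rel)); apply/lquot_pi_eq; rewrite subr0.
exact/in_span_rel/KaehlerM.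
Qed.

Lemma kdC c : kd (iota c) = 0.
Proof.
rewrite -(linear0 (lquot_pi kaehler_rel)); apply/lquot_pi_eq; rewrite subr0.
exact/in_span_rel/KaehlerC.
Qed.

Definition derivation (N : lmodType A) (D : A -> N) : Prop :=
  [/\ forall a b, D (a + b) = D a + D b,
      forall a b, D (a * b) = a *: D b + b *: D a
    & forall c, D (iota c) = 0].

Definition kaehler_lift (N : lmodType A) (D : A -> N) : kaehler -> N :=
  lquot_lift (fglift D).

Lemma kaehler_lift_rel (N : lmodType A) (D : A -> N) : derivation D ->
  forall u, kaehler_rel u -> fglift D u = 0.
Proof.
case=> dD dM dC _ [a b|a b|c]; rewrite ?fgliftB ?fgliftZ !fglift1 //=.
  by rewrite dD -addrA -opprD subrr.
by rewrite dM -addrA -opprD subrr.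
Qed.

Lemma kaehler_lift_d (N : lmodType A) (D : A -> N) a : derivation D ->
  kaehler_lift D (kd a) = D a.
Proof.
move=> hD; rewrite /kaehler_lift lquot_liftE /= ?fglift1 //.
exact: (kaehler_lift_rel hD).
Qed.

Lemma kaehler_lift_linear (N : lmodType A) (D : A -> N) : derivation D ->
  linear (kaehler_lift D).
Proof. by move=> hD; apply/lquot_lift_linear/kaehler_lift_rel. Qed.

End Kaehler.

(* * Exterior square *)

Section ExteriorSquare.
Variables (A : nzRingType) (M : lmodType A).

Variant ext2_rel : {freeg (M * M)%type / A} -> Prop :=
| Ext2l a u u' v :
    ext2_rel (<< (a *: u + u', v) >> - a *: << (u, v) >> - << (u', v) >>)
| Ext2r a u v v' :
    ext2_rel (<< (u, a *: v + v') >> - a *: << (u, v) >> - << (u, v') >>)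
| Ext2alt u : ext2_rel (<< (u, u) >>).

Definition ext2 := lquot ext2_rel.
HB.instance Definition _ := GRing.Lmodule.on ext2.

Definition wedge (u v : M) : ext2 := lquot_pi ext2_rel (<< (u, v) >>).

Lemma wedgePl a u u' v : wedge (a *: u + u') v = a *: wedge u v + wedge u' v.
Proof.
apply/eqP; rewrite -subr_eq0 opprD addrA -!linearZ -!raddfB /=; apply/eqP.
rewrite -(linear0 (lquot_pi ext2_rel)); apply/lquot_pi_eq; rewrite subr0.
exact/in_span_rel/Ext2l.
Qed.

Lemma wedgePr a u v v' : wedge u (a *: v + v') = a *: wedge u v + wedge u v'.
Proof.
apply/eqP; rewrite -subr_eq0 opprD addrA -!linearZ -!raddfB /=; apply/eqP.
rewrite -(linear0 (lquot_pi ext2_rel)); apply/lquot_pi_eq; rewrite subr0.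
exact/in_span_rel/Ext2r.
Qed.

Lemma wedge_alt u : wedge u u = 0.
Proof.
rewrite -(linear0 (lquot_pi ext2_rel)); apply/lquot_pi_eq; rewrite subr0.
exact/in_span_rel/Ext2alt.
Qed.

Definition alternating (N : lmodType A) (b : M -> M -> N) : Prop :=
  [/\ forall a u u' v, b (a *: u + u') v = a *: b u v + b u' v,
      forall a u v v', b u (a *: v + v') = a *: b u v + b u v'
    & forall u, b u u = 0].

Definition ext2_lift (N : lmodType A) (b : M -> M -> N) : ext2 -> N :=
  lquot_lift (fglift (fun uv : M * M => b uv.1 uv.2)).

Lemma ext2_lift_rel (N : lmodType A) (b : M -> M -> N) : alternating b ->
  forall u, ext2_rel u -> fglift (fun uv : M * M => b uv.1 uv.2) u = 0.
Proof.
case=> bl br b0 _ [a u u' v|a u v v'|u];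
  rewrite ?fgliftB ?fgliftZ !fglift1 //=.
  by rewrite bl -addrA -opprD subrr.
by rewrite br -addrA -opprD subrr.
Qed.

Lemma ext2_lift_wedge (N : lmodType A) (b : M -> M -> N) u v :
  alternating b -> ext2_lift b (wedge u v) = b u v.
Proof.
move=> hb; rewrite /ext2_lift lquot_liftE /= ?fglift1 //.
exact: (ext2_lift_rel hb).
Qed.

Lemma ext2_lift_linear (N : lmodType A) (b : M -> M -> N) :
  alternating b -> linear (ext2_lift b).
Proof. by move=> hb; apply/lquot_lift_linear/ext2_lift_rel. Qed.

End ExteriorSquare.

(* * Functoriality *)

Section RestrictScalars.
Variables (A B : nzRingType) (f : {rmorphism A -> B}) (N : lmodType B).

Definition restrict : Type := let _ := f in N.
HB.instance Definition _ := GRing.Zmodule.on restrict.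

Definition restrict_scale (a : A) (x : restrict) : restrict :=
  (f a *: (x : N) : N).

Fact restrict_scaleA a b x :
  restrict_scale a (restrict_scale b x) = restrict_scale (a * b) x.
Proof. by rewrite /restrict_scale scalerA rmorphM. Qed.
Fact restrict_scale1 : left_id 1 restrict_scale.
Proof. by move=> x; rewrite /restrict_scale rmorph1 scale1r. Qed.
Fact restrict_scaleDr : right_distributive restrict_scale +%R.
Proof. by move=> a x y; apply: scalerDr. Qed.
Fact restrict_scaleDl x : {morph restrict_scale^~ x : a b / a + b}.
Proof. by move=> a b; rewrite /restrict_scale rmorphD; apply: scalerDl. Qed.

HB.instance Definition _ := GRing.Zmodule_isLmodule.Build A restrict
  restrict_scaleA restrict_scale1 restrict_scaleDr restrict_scaleDl.

Lemma restrictZ a (x : restrict) : a *: x = (f a *: (x : N) : N).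
Proof. by []. Qed.

End RestrictScalars.

(* For a morphism [f] of rings commuting with the structure maps, the maps
   a d b |-> f a d (f b) on differentials and on their exterior squares; they
   are [f]-semilinear, hence obtained by lifting to restrictions of scalars. *)
Section Functoriality.
Variables (k : Type) (A B : nzRingType) (iA : k -> A) (iB : k -> B).
Variables (f : {rmorphism A -> B}).

Definition kaehler_map : kaehler iA -> kaehler iB :=
  kaehler_lift (fun a => kd iB (f a) : restrict f (kaehler iB)).

Definition ext2_kaehler_map : ext2 (kaehler iA) -> ext2 (kaehler iB) :=
  ext2_lift (fun u v => wedge (kaehler_map u) (kaehler_map v)
    : restrict f (ext2 (kaehler iB))).

Hypothesis fi : forall c, f (iA c) = iB c.

Fact kaehler_map_derivation :
  derivation iA (fun a => kd iB (f a) : restrict f (kaehler iB)).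
Proof.
split=> [a b|a b|c]; first by rewrite rmorphD kdD.
  by rewrite rmorphM kdM.
by rewrite fi kdC.
Qed.

Lemma kaehler_map_d a : kaehler_map (kd iA a) = kd iB (f a).
Proof. exact: (kaehler_lift_d a kaehler_map_derivation). Qed.

Lemma kaehler_mapP a u v :
  kaehler_map (a *: u + v) = f a *: kaehler_map u + kaehler_map v.
Proof. exact: (kaehler_lift_linear kaehler_map_derivation). Qed.

Fact ext2_kaehler_map_alternating :
  alternating (fun u v => wedge (kaehler_map u) (kaehler_map v)
    : restrict f (ext2 (kaehler iB))).
Proof.
split=> [a u u' v|a u v v'|u]; last exact: wedge_alt.
  by rewrite kaehler_mapP wedgePl.
by rewrite kaehler_mapP wedgePr.
Qed.

Lemma ext2_kaehler_map_wedge u v :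
  ext2_kaehler_map (wedge u v) = wedge (kaehler_map u) (kaehler_map v).
Proof. exact: (ext2_lift_wedge _ _ ext2_kaehler_map_alternating). Qed.

Lemma ext2_kaehler_mapP a u v :
  ext2_kaehler_map (a *: u + v)
  = f a *: ext2_kaehler_map u + ext2_kaehler_map v.
Proof. exact: (ext2_lift_linear ext2_kaehler_map_alternating). Qed.

End Functoriality.

(* * Generated subalgebras, as rings with a structure map from [k] *)

Section GeneratedSubalgebra.
Variables (k E : comNzRingType) (iota : {rmorphism k -> E}).

Inductive in_alg_gen (S : E -> Prop) : E -> Prop :=
| in_alg_scalar c : in_alg_gen S (iota c)
| in_alg_mem x : S x -> in_alg_gen S x
| in_algD x y : in_alg_gen S x -> in_alg_gen S y -> in_alg_gen S (x + y)
| in_algM x y : in_alg_gen S x -> in_alg_gen S y -> in_alg_gen S (x * y).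

Definition alg_gen (S : E -> Prop) : {pred E} := fun x => `[< in_alg_gen S x >].

Lemma alg_gen_closed S : subring_closed (alg_gen S).
Proof.
split=> [|u v|u v].
- by apply/asboolP; rewrite -(rmorph1 iota); apply: in_alg_scalar.
- move=> /asboolP su /asboolP sv; apply/asboolP; apply: in_algD => //.
  rewrite -mulN1r -(rmorph1 iota) -rmorphN; apply: in_algM => //.
  exact: in_alg_scalar.
- by move=> /asboolP su /asboolP sv; apply/asboolP; apply: in_algM.
Qed.

HB.instance Definition _ S :=
  GRing.isSubringClosed.Build E (alg_gen S) (alg_gen_closed S).

Definition subalg (S : E -> Prop) : Type := {x : E | alg_gen S x}.
HB.instance Definition _ S := SubChoice.on (subalg S).
HB.instance Definition _ S := [SubChoice_isSubComNzRing of subalg S by <:].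

Lemma alg_gen_scalar S c : alg_gen S (iota c).
Proof. by apply/asboolP; apply: in_alg_scalar. Qed.

Definition subalg_scalar S (c : k) : subalg S :=
  exist (alg_gen S) (iota c) (alg_gen_scalar S c).

Definition subalg_val S : {rmorphism subalg S -> E} := \val.

(* The form [w] lies in the image of the 2-forms on the subalgebra generated by
   [S]. *)
Definition regular_form2 S (w : ext2 (kaehler iota)) : Prop :=
  exists v : ext2 (kaehler (subalg_scalar S)),
    ext2_kaehler_map iota (subalg_val S) v = w.

End GeneratedSubalgebra.

(* * Seeds and mutations *)

Section Cluster.
Variables (m n : nat) (le_mn : (m <= n)%N).

Local Notation col_of := (widen_ord le_mn).

Definition symmetrizer (D : 'M[int]_m) (A : 'M[int]_(m, n)) : Prop :=
  [/\ is_diag_mx D, forall i, 0 < D i i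
    & (colsub col_of (D *m A))^T = - colsub col_of (D *m A)].

Definition skew_symmetrizable (A : 'M[int]_(m, n)) : Prop :=
  exists D, symmetrizer D A.

(* The numerator is always even, so that the integer division is exact. *)
Definition mutate_mx (k : 'I_m) (B : 'M[int]_(m, n)) : 'M[int]_(m, n) :=
  \matrix_(i, j)
    if (i == k) || (j == col_of k) then - B i j
    else B i j + ((`|B i (col_of k)| * B k j
                   + B i (col_of k) * `|B k j|) %/ 2)%Z.

(* The closed walk i, s_1, s_2, ...  with at least one step. *)
Definition directed_cycle (B : 'M[int]_(m, n)) (i : 'I_m) (s : seq 'I_m) :=
  [&& s != [::], path (fun a b => 0 < B a (col_of b)) i s & last i s == i].

Definition acyclic_mx (B : 'M[int]_(m, n)) : Prop :=
  forall i s, ~~ directed_cycle B i s.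

Variable C : fieldType.

Definition ratfun := {fraction {mpoly C[n]}}.
HB.instance Definition _ := GRing.Field.on ratfun.

Definition const_ratfun : {rmorphism C -> ratfun} :=
  (@FracField.tofrac {mpoly C[n]}) \o (@mpolyC n C).

Definition seed := ('M[int]_(m, n) * {ffun 'I_n -> ratfun})%type.

Definition mutate (s : seed) (k : 'I_m) : seed :=
  let: (B, f) := s in
  (mutate_mx k B,
   [ffun i => if i == col_of k then
      (f i)^-1 * (\prod_(j | 0 < B k j) f j ^+ `|B k j|
                  + \prod_(j | B k j < 0) f j ^+ `|B k j|)
    else f i]).

Definition initial_seed (A : 'M[int]_(m, n)) : seed :=
  (A, [ffun i => FracField.tofrac 'X_i]).

(* Seeds equivalent to the initial seed. *)
Definition seed_of (A : 'M[int]_(m, n)) (s : seed) : Prop :=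
  exists ks : seq 'I_m, s = foldl mutate (initial_seed A) ks.

Definition cluster_gen (A : 'M[int]_(m, n)) (x : ratfun) : Prop :=
  (exists2 s, seed_of A s & exists i, x = s.2 i)
  \/ (exists2 i : 'I_n, (m <= i)%N & x = (FracField.tofrac 'X_i)^-1).

Definition cluster_algebra (A : 'M[int]_(m, n)) :=
  subalg const_ratfun (cluster_gen A).

Definition acyclic_cluster_algebra (A : 'M[int]_(m, n)) : Prop :=
  exists2 s, seed_of A s & acyclic_mx s.1.

Definition rational_form2 := ext2 (kaehler const_ratfun).
HB.instance Definition _ := GRing.Lmodule.on rational_form2.

(* The form of the seed [(B, f)] is [wp_form B f].  When the principal part of
   [B] is skew-symmetrizable but not skew-symmetric, mutation need not preserve
   [wp_form B f], not even modulo regular forms; it is [wp_form (D *m B) f],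
   for [D] a symmetrizer, that is well behaved.  Both are used; they coincide
   for D = 1 when the principal part of [B] is skew-symmetric.  As the sum omits
   the pairs of frozen indices, even [wp_form (D *m B) f] is preserved only up
   to a combination of d x_i / x_i /\ d x_j / x_j with x_i, x_j frozen, which
   is regular; hence the two ways of referring to the form: through
   [weil_petersson], or seed by seed. *)
Definition wp_form (M : 'M[int]_(m, n)) (f : 'I_n -> ratfun) : rational_form2 :=
  \sum_(i < m) \sum_(j < n | (i < j)%N)
    ((M i j)%:~R / (f (col_of i) * f j))
    *: wedge (kd const_ratfun (f (col_of i))) (kd const_ratfun (f j)).

(* [w] comes from a 2-form on the ring [cluster_algebra A]. *)
Definition regular_on (A : 'M[int]_(m, n)) (w : rational_form2) : Prop :=
  regular_form2 (cluster_gen A) w.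

(* [w] is the common value of the forms of all seeds equivalent to the initial
   one. *)
Definition weil_petersson (A : 'M[int]_(m, n)) (w : rational_form2) : Prop :=
  forall s, seed_of A s -> w = wp_form s.1 s.2.

End Cluster.

(* Main.v *)
From HB Require Import structures.
Require Import Defs.
From mathcomp Require Import all_boot all_order all_algebra.
From mathcomp Require Import fraction boolp freeg mpoly.
From mathcomp Require Import reals.
From mathcomp Require Import complex.
From mathcomp Require Import ring zify.

Set Implicit Arguments.
Unset Strict Implicit.
Unset Printing Implicit Defensive.

Import Order.TTheory GRing.Theory Num.Theory.
Local Open Scope ring_scope.

(** Why the form is regular.  Regular forms make up a module over the cluster
    algebra, so the elements of the algebra that multiply a given form into a
    regular one, up to powers, make up a radical ideal ([clears]); it is enough
    to show that this ideal is the unit ideal.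

    In one cluster f, twice the form is the sum of W i j dlog f_i /\ dlog f_j
    over all pairs, for an antisymmetric integer matrix W ([log_form]), and the
    argument needs of W only that each of its mutable rows is a scalar multiple
    of the corresponding row of the exchange matrix B.  Then the part of the
    form that has a pole along f_k = 0 is a multiple of dlog f_k /\ dlog y_k,
    where y_k = p+ / p- is the ratio of the two exchange monomials.  Since
    f_k f_k' = p+ + p-, that form equals
      df_k /\ df_k' / p+  -  f_k' df_k /\ dp- / (p+ p-),
    with no pole along f_k = 0 ([exchange_wedge]).  Hence, for a set S of pairwise
    unlinked mutable indices, the form becomes regular once the variables
    outside S are inverted ([log_form_independent]).  For an acyclic B the
    condition of having no links inside S can be dropped one edge at a time.  A
    linked S has an index i with an edge to some j in S and no edge from S.
    Then p- involves only inverted variables, while p+ is divisible by f_j, so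
    p- = f_i f_i' - p+ shows that f_i and f_j generate the unit ideal after the
    inversion, and it is enough to treat S without i and S without j
    ([clears_prod_off]).  When S is everything only frozen variables are
    inverted, and these are units ([log_form_regular]).

    For W = D B extended antisymmetrically, mutation preserves the form if the
    coefficients of frozen pairs are corrected suitably ([log_form_mutated]),
    and frozen pairs contribute regular forms anyway; so regularity passes from
    the acyclic seed to every seed ([wp_form_scaled_regular]).

    For W = B the rows of the antisymmetric extension need not be multiples of
    those of B when B is not skew-symmetric.  But suppose that the form is the
    same before and after the mutation at k, and evaluate both expressions on
    pairs of derivations dual to the logarithms of the cluster.  All matrix
    coefficients are constants, whereas the difference of the two sides contains
    p+ / (p+ + p-) with coefficient B_ki W_kj - B_kj W_ki; as this ratio is not
    constant, row k of W is proportional to row k of B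
    ([mutation_invariant_proportional]).  The dual derivations exist for the
    initial cluster, where they are the Euler operators x_i d/dx_i
    ([initial_log_frame]), and can be mutated along with the cluster
    ([log_frame_mutated]); they also show that the exchange polynomial p+ + p-
    never vanishes. *)

(** * Logarithmic derivatives *)

Section LogDerivative.
Variables (C K : fieldType) (iota : {rmorphism C -> K}).
Variables (N : lmodType K) (D : K -> N) (hD : derivation iota D).

(** Over an arbitrary module, so that the same computations serve both for the
    universal derivation and for scalar-valued ones. *)
Definition logd (x : K) : N := x^-1 *: D x.

Lemma derivation1 : D 1 = 0.
Proof. by case: hD => _ _ /(_ 1); rewrite rmorph1. Qed.

Lemma derivation0 : D 0 = 0.
Proof. by case: hD => _ _ /(_ 0); rewrite rmorph0. Qed.

Lemma derivationE x : x != 0 -> D x = x *: logd x.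
Proof. by move=> x0; rewrite /logd scalerA divff // scale1r. Qed.

Lemma logd1 : logd 1 = 0.
Proof. by rewrite /logd derivation1 scaler0. Qed.

Lemma logdM x y : x != 0 -> y != 0 -> logd (x * y) = logd x + logd y.
Proof.
case: hD => _ dM _ x0 y0; rewrite /logd dM scalerDr !scalerA invfM.
by rewrite mulrAC mulVf // mul1r -mulrA mulVf // mulr1 addrC.
Qed.

Lemma logdV x : x != 0 -> logd x^-1 = - logd x.
Proof.
move=> x0; apply: (addrI (logd x)).
by rewrite -logdM ?invr_eq0 // divff // logd1 subrr.
Qed.

Lemma logdX x n : x != 0 -> logd (x ^+ n) = n%:R *: logd x.
Proof.
move=> x0; elim: n => [|n IH]; first by rewrite expr0 logd1 scale0r.
by rewrite exprS logdM ?expf_neq0 // IH -addn1 natrD scalerDl scale1r addrC.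
Qed.

Lemma logd_prod (I : finType) (f : I -> K) (a : I -> nat) :
  (forall i, f i != 0) ->
  logd (\prod_i f i ^+ a i) = \sum_i (a i)%:R *: logd (f i).
Proof.
move=> f0; suff [] : \prod_i f i ^+ a i != 0 /\
    logd (\prod_i f i ^+ a i) = \sum_i (a i)%:R *: logd (f i) by [].
apply: (big_rec2 (fun x y => x != 0 /\ logd x = y)) => [|i x y _ [x0 xy]].
  by rewrite oner_neq0 logd1.
by rewrite mulf_neq0 ?expf_neq0 // logdM ?expf_neq0 // logdX ?xy.
Qed.

End LogDerivative.

(** * Two-forms *)

Section Wedge.
Variables (K : fieldType) (M : lmodType K).
Implicit Types u v : M.

Fact wedger_linear u : linear (wedge u).
Proof. by move=> a v v'; apply: wedgePr. Qed.
HB.instance Definition _ u :=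
  GRing.isLinear.Build K M (ext2 M) _ (wedge u) (wedger_linear u).

Lemma wedgeZr a u v : wedge u (a *: v) = a *: wedge u v.
Proof. exact: (linearZ_LR (wedge u)). Qed.
Lemma wedgeDr u v v' : wedge u (v + v') = wedge u v + wedge u v'.
Proof. exact: (linearD (wedge u)). Qed.
Lemma wedgeNr u v : wedge u (- v) = - wedge u v.
Proof. exact: (linearN (wedge u)). Qed.

Lemma wedgeC u v : wedge u v = - wedge v u.
Proof.
have := wedge_alt (u + v); rewrite wedgeDr.
have dl w : wedge (u + v) w = wedge u w + wedge v w.
  by have := wedgePl 1 u v w; rewrite !scale1r.
by rewrite !dl !wedge_alt add0r addr0 addrC => /eqP; rewrite addr_eq0 => /eqP.
Qed.

Lemma wedgeZl a u v : wedge (a *: u) v = a *: wedge u v.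
Proof. by rewrite wedgeC wedgeZr -scalerN -wedgeC. Qed.
Lemma wedgeDl u u' v : wedge (u + u') v = wedge u v + wedge u' v.
Proof. by rewrite wedgeC wedgeDr opprD -!wedgeC. Qed.
Lemma wedgeNl u v : wedge (- u) v = - wedge u v.
Proof. by rewrite wedgeC wedgeNr -wedgeC. Qed.

Lemma wedge_sumr u (I : Type) (r : seq I) (P : pred I) (F : I -> M) :
  wedge u (\sum_(i <- r | P i) F i) = \sum_(i <- r | P i) wedge u (F i).
Proof. exact: (linear_sum (wedge u)). Qed.
Lemma wedge_suml v (I : Type) (r : seq I) (P : pred I) (F : I -> M) :
  wedge (\sum_(i <- r | P i) F i) v = \sum_(i <- r | P i) wedge (F i) v.
Proof.
by rewrite wedgeC wedge_sumr -sumrN; apply: eq_bigr => i _; rewrite -wedgeC.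
Qed.

End Wedge.

Section Regular.
Variables (C K : fieldType) (iota : {rmorphism C -> K}) (S : K -> Prop).
Local Notation alg := (in_alg_gen iota S).
Local Notation reg := (regular_form2 (iota := iota) S).
Local Notation d := (kd iota).

Lemma in_alg1 : alg 1.
Proof. by rewrite -(rmorph1 iota); apply: in_alg_scalar. Qed.

Lemma in_algX x n : alg x -> alg (x ^+ n).
Proof.
move=> ax; elim: n => [|n IH]; first exact: in_alg1.
by rewrite exprS; apply: in_algM.
Qed.

Lemma in_algB x y : alg x -> alg y -> alg (x - y).
Proof.
move=> ax ay; apply: in_algD => //; rewrite -mulN1r -(rmorph1 iota) -rmorphN.
by apply: in_algM => //; apply: in_alg_scalar.
Qed.

Lemma in_alg_int (z : int) : alg z%:~R.
Proof. by rewrite -(rmorph_int iota); apply: in_alg_scalar. Qed.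

Lemma in_alg_prod (I : Type) (r : seq I) (P : pred I) (F : I -> K) :
  (forall i, P i -> alg (F i)) -> alg (\prod_(i <- r | P i) F i).
Proof.
by move=> aF; apply: big_ind => //; [apply: in_alg1 | apply: in_algM].
Qed.

Lemma in_alg_val x : alg x -> exists y, subalg_val iota S y = x.
Proof. by move=> ax; exists (exist (alg_gen iota S) x (asboolT ax)). Qed.

Lemma regularP a v w : alg a -> reg v -> reg w -> reg (a *: v + w).
Proof.
move=> /in_alg_val[b <-] [v' <-] [w' <-]; exists (b *: v' + w').
exact: ext2_kaehler_mapP.
Qed.

Lemma regular0 : reg 0.
Proof.
exists 0; have := @ext2_kaehler_mapP _ _ _ (subalg_scalar iota S) iota
  (subalg_val iota S) (fun=> erefl) (-1) 0 0.
by rewrite scaler0 addr0 rmorphN1 scaleN1r addNr.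
Qed.

Lemma regularZ a v : alg a -> reg v -> reg (a *: v).
Proof. by move=> aa rv; rewrite -[_ *: _]addr0; apply/regularP/regular0. Qed.

Lemma regularD v w : reg v -> reg w -> reg (v + w).
Proof.
by move=> rv rw; rewrite -[v]scale1r; apply: regularP => //; apply: in_alg1.
Qed.

Lemma regular_sum (I : Type) (r : seq I) (P : pred I)
    (F : I -> ext2 (kaehler iota)) :
  (forall i, P i -> reg (F i)) -> reg (\sum_(i <- r | P i) F i).
Proof.
by move=> rF; apply: big_ind => //; [apply: regular0 | apply: regularD].
Qed.

Lemma regular_wedge a b : alg a -> alg b -> reg (wedge (d a) (d b)).
Proof.
move=> /in_alg_val[x <-] /in_alg_val[y <-].
exists (wedge (kd (subalg_scalar iota S) x) (kd (subalg_scalar iota S) y)).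
by rewrite ext2_kaehler_map_wedge // !kaehler_map_d.
Qed.

End Regular.

(** * Localization and exchange relations *)

Section Localization.
Variables (C K : fieldType) (iota : {rmorphism C -> K}) (S : K -> Prop).
Local Notation alg := (in_alg_gen iota S).
Local Notation reg := (regular_form2 (iota := iota) S).

Section Invert.
Variables (u : K) (alg_u : alg u).

Definition alg_loc (a : K) := exists N, alg (u ^+ N * a).
Definition reg_loc (w : ext2 (kaehler iota)) := exists N, reg (u ^+ N *: w).
(** Becoming invertible, with inverse coming from the algebra, once u is. *)
Definition divides_power (a : K) := exists N q, alg q /\ a * q = u ^+ N.

Lemma alg_loc_alg a : alg a -> alg_loc a.
Proof. by exists 0; rewrite mul1r. Qed.

Lemma alg_locM a b : alg_loc a -> alg_loc b -> alg_loc (a * b).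
Proof.
move=> [N aN] [M bM]; exists (N + M)%N.
by rewrite exprD mulrACA; apply: in_algM.
Qed.

Lemma alg_locV a : a != 0 -> divides_power a -> alg_loc a^-1.
Proof.
by move=> a0 [N [q [aq eq_aq]]]; exists N; rewrite -eq_aq mulrAC divff ?mul1r.
Qed.

Lemma reg_loc_reg w : reg w -> reg_loc w.
Proof. by exists 0; rewrite scale1r. Qed.

Lemma reg_locZ a w : alg_loc a -> reg_loc w -> reg_loc (a *: w).
Proof.
move=> [N aN] [M wM]; exists (N + M)%N.
by rewrite exprD scalerA mulrAC -scalerA; apply: regularZ.
Qed.

Lemma reg_locD v w : reg_loc v -> reg_loc w -> reg_loc (v + w).
Proof.
move=> [N vN] [M wM]; exists (N + M)%N; rewrite scalerDr; apply: regularD.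
  by rewrite addnC exprD -scalerA; apply: regularZ => //; apply: in_algX.
by rewrite exprD -scalerA; apply: regularZ => //; apply: in_algX.
Qed.

Lemma reg_loc_sum (I : Type) (r : seq I) (P : pred I)
    (F : I -> ext2 (kaehler iota)) :
  (forall i, P i -> reg_loc (F i)) -> reg_loc (\sum_(i <- r | P i) F i).
Proof.
move=> rF; apply: big_ind => //; last exact: reg_locD.
exact/reg_loc_reg/regular0.
Qed.

Lemma divides_powerM a b :
  divides_power a -> divides_power b -> divides_power (a * b).
Proof.
move=> [N [q [aq eq_q]]] [M [q' [aq' eq_q']]]; exists (N + M)%N, (q * q').
by split; [apply: in_algM | rewrite mulrACA eq_q eq_q' exprD].
Qed.

Lemma divides_power1 : divides_power 1.
Proof. by exists 0, 1; rewrite mulr1; split=> //; apply: in_alg1. Qed.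

Lemma divides_powerX a n : divides_power a -> divides_power (a ^+ n).
Proof.
move=> da; elim: n => [|n IH]; first exact: divides_power1.
by rewrite exprS; apply: divides_powerM.
Qed.

End Invert.

Variable w : ext2 (kaehler iota).

(** The radical of the ideal of denominators of w: the product and sum lemmas
    below say that it is an ideal. *)
Definition clears (r : K) := alg r /\ exists N, reg (r ^+ N *: w).

Lemma clearsM r a : clears r -> alg a -> clears (r * a).
Proof.
move=> [ar [N rN]] aa; split; first exact: in_algM.
by exists N; rewrite exprMn mulrC -scalerA; apply/regularZ/rN/in_algX.
Qed.

(** In the binomial expansion of (r + s) ^ (N + M), each term contains r ^ N or
    s ^ M. *)
Lemma clearsD r s : clears r -> clears s -> clears (r + s).
Proof.
move=> [ar [N rN]] [as_ [M sM]]; split; first exact: in_algD.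
exists (N + M)%N; rewrite exprDn scaler_suml; apply: regular_sum => i _.
rewrite -mulr_natl -scalerA; apply: regularZ.
  by have := in_alg_int iota S 'C(N + M, i).
case: (leqP M i) => [le_Mi | lt_iM].
  rewrite -(subnK le_Mi) exprD mulrA -scalerA; apply/regularZ/sM.
  by apply: in_algM; apply: in_algX.
have le_N : (N <= N + M - i)%N by rewrite leq_subRL; lia.
rewrite -(subnK le_N) exprD mulrAC -scalerA; apply/regularZ/rN.
by apply: in_algM; apply: in_algX.
Qed.

Lemma clears_dvd u p : alg u -> clears (u * p) -> divides_power u p -> clears u.
Proof.
move=> au [_ [N upN]] [L [q [aq pq]]]; split=> //; exists (N + L * N)%N.
have -> : u ^+ (N + L * N) = q ^+ N * (u * p) ^+ N.
  by rewrite exprD exprM -pq !exprMn; ring.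
by rewrite -scalerA; apply: regularZ => //; apply: in_algX.
Qed.

End Localization.

Definition zpos (z : int) : nat := if z is Posz n then n else 0.

Section ExchangeMonomials.
Variables (K : fieldType) (I : finType) (f : I -> K) (b : I -> int).

Definition mpos : K := \prod_i f i ^+ zpos (b i).
Definition mneg : K := \prod_i f i ^+ zpos (- b i).

Hypothesis f_neq0 : forall i, f i != 0.

Lemma mpos_neq0 : mpos != 0.
Proof. by apply/prodf_neq0 => i _; rewrite expf_neq0. Qed.

Lemma mneg_neq0 : mneg != 0.
Proof. by apply/prodf_neq0 => i _; rewrite expf_neq0. Qed.

End ExchangeMonomials.

Lemma zposB z : ((zpos z)%:Z - (zpos (- z))%:Z) = z.
Proof. by case: z => [[|n]|n] //=; rewrite ?subr0 ?sub0r. Qed.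

Section Exchange.
Variables (C K : fieldType) (iota : {rmorphism C -> K}).
Local Notation d := (kd iota).
Definition dlog : K -> kaehler iota := logd (kd iota).

Lemma kd_derivation : derivation iota d.
Proof. by split; [apply: kdD | apply: kdM | apply: kdC]. Qed.

Lemma wedge_dlog x y :
  wedge (dlog x) (dlog y) = (x^-1 * y^-1) *: wedge (d x) (d y).
Proof. by rewrite /dlog /logd wedgeZl wedgeZr scalerA. Qed.

(** The pole along x cancels: p dlog (p / q) = dp - (p / q) dq, and substituting
    dp = d (x x') - dq turns this into x dx' + x' dx - (x x' / q) dq, where the dx
    term is killed by the wedge with dx and the others are divisible by x. *)
Lemma exchange_wedge x x' p q :
  x != 0 -> p != 0 -> q != 0 -> x * x' = p + q ->
  wedge (dlog x) (dlog p - dlog q)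
  = p^-1 *: wedge (d x) (d x') - (x' / (p * q)) *: wedge (d x) (d q).
Proof.
move=> x0 p0 q0 xx'.
have dp : d p = x *: d x' + x' *: d x - d q.
  by rewrite -kdM xx' kdD addrK.
rewrite wedgeDr wedgeNr !wedge_dlog dp !wedgeDr wedgeNr !wedgeZr wedge_alt.
rewrite scaler0 addr0 scalerDr scalerN scalerA -addrA -opprD -scalerDl.
congr (_ *: _ - _ *: _); first by rewrite mulrAC mulVf ?mul1r.
have -> : q = x * x' - p by rewrite xx' addrAC subrr add0r.
have : x * x' - p != 0 by rewrite xx' addrAC subrr add0r.
by move=> h; field; rewrite x0 p0 h.
Qed.

(** The sum on the right is the logarithmic derivative of y = p+ / p-. *)
Lemma logd_ratio (N : lmodType K) (D : K -> N) (I : finType) (f : I -> K)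
    (b : I -> int) : derivation iota D -> (forall i, f i != 0) ->
  logd D (mpos f b) - logd D (mneg f b) = \sum_i (b i)%:~R *: logd D (f i).
Proof.
move=> hD f0; rewrite !(logd_prod hD) // -sumrB; apply: eq_bigr => i _.
by rewrite -scalerBl -{3}[b i]zposB rmorphB.
Qed.

End Exchange.

(** The use of this splitting is to write a form whose coefficients vanish inside
    S as full rows indexed by S plus terms that avoid S. *)
Lemma sum_symmetric (I : finType) (P : pred I) (V : nmodType) (F : I -> I -> V) :
  (forall i j, F i j = F j i) -> (forall i j, P i -> P j -> F i j = 0) ->
  \sum_i \sum_j F i j = \sum_(i | P i) \sum_j F i j
    + (\sum_(i | P i) \sum_j F i j + \sum_(i | ~~ P i) \sum_(j | ~~ P j) F i j).
Proof.
move=> FC F0; rewrite (bigID P) /=; congr (_ + _).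
under eq_bigr => i _ do rewrite (bigID P) /=.
rewrite big_split /= exchange_big /=; congr (_ + _).
apply: eq_bigr => i Pi; rewrite [RHS](bigID P) /= [X in _ = X + _]big1 => [|j Pj].
  by rewrite add0r; apply: eq_bigr => j _; rewrite FC.
exact: F0.
Qed.

(** * Regularity at an acyclic cluster *)

Section Source.
Variables (J : finType) (e : rel J).
Hypothesis e_acyclic :
  forall i s, ~~ [&& s != [::], path e i s & last i s == i].

(** An element of S with the fewest ancestors: a predecessor of it inside S would
    have strictly fewer, because the element itself is not among them. *)
Lemma acyclic_source (S : {set J}) i0 : i0 \in S ->
  exists2 i, i \in S & forall j, j \in S -> ~~ e j i.
Proof.
move=> Si0; pose anc i := #|[set j | connect e j i]|.
case: (@arg_minnP _ i0 [pred i in S] anc Si0) => i /= Si min_i.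
exists i => // j Sj; apply/negP => eji.
have := min_i j Sj; rewrite leqNgt => /negP; apply.
apply: proper_card; apply/properP; split.
  by apply/subsetP=> l; rewrite !inE => clj; apply/(connect_trans clj)/connect1.
exists i; rewrite !inE ?connect0 //; apply/negP => /connectP[p pth j_last].
have /negP := e_acyclic i (rcons p i); apply.
rewrite last_rcons eqxx andbT rcons_path pth -j_last eji /=.
by case: (p).
Qed.

End Source.

Section AcyclicCluster.
Variables (C K : fieldType) (iota : {rmorphism C -> K}) (gen : K -> Prop).
Local Notation alg := (in_alg_gen iota gen).
Local Notation reg := (regular_form2 (iota := iota) gen).

Variables (I J : finType) (col : J -> I) (B : J -> I -> int).
Variables (f : I -> K) (f' : J -> K) (W : I -> I -> int).

(** The sum runs over ordered pairs, hence counts each wedge twice when W is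
    antisymmetric. *)
Definition log_form : ext2 (kaehler iota) :=
  \sum_i \sum_j (W i j)%:~R *: wedge (dlog iota (f i)) (dlog iota (f j)).

Hypothesis col_inj : injective col.
Hypothesis f_neq0 : forall i, f i != 0.
Hypothesis alg_f : forall i, alg (f i).
Hypothesis alg_f' : forall k, alg (f' k).
Hypothesis alg_fV : forall i, i \notin codom col -> alg (f i)^-1.
Hypothesis exchange : forall k, f (col k) * f' k = mpos f (B k) + mneg f (B k).
Hypothesis B_sign : forall i j, B i (col j) < 0 -> 0 < B j (col i).
Hypothesis B_acyclic : forall i s,
  ~~ [&& s != [::], path (fun a b => 0 < B a (col b)) i s & last i s == i].
Hypothesis W_anti : forall i j, W i j = - W j i.
Hypothesis W_row : forall k, exists2 c, alg c &
  forall j, (W (col k) j)%:~R = c * (B k j)%:~R :> K.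

Let prod_off (S : {set J}) : K := \prod_(i | i \notin col @: S) f i.

Let alg_prod_off S : alg (prod_off S).
Proof. exact: in_alg_prod. Qed.

Let dvd_prod_off (S : {set J}) i :
  i \notin col @: S -> divides_power iota gen (prod_off S) (f i).
Proof.
move=> Si; exists 1%N, (\prod_(j | (j \notin col @: S) && (j != i)) f j).
split; first exact: in_alg_prod.
by rewrite [RHS](bigD1 i Si).
Qed.

Let dvd_prod_off_prod (S : {set J}) (a : I -> nat) :
  (forall i, i \in col @: S -> a i = 0%N) ->
  divides_power iota gen (prod_off S) (\prod_i f i ^+ a i).
Proof.
move=> a0; apply: big_ind => [|x y|i _].
- exact: divides_power1.
- exact: divides_powerM.
have [Si|Si] := boolP (i \in col @: S); last exact/divides_powerX/dvd_prod_off.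
by rewrite a0 // expr0; apply: divides_power1.
Qed.

Let prod_offD1 (S : {set J}) k :
  k \in S -> prod_off (S :\ k) = prod_off S * f (col k).
Proof.
move=> Sk; rewrite /prod_off mulrC (bigD1 (col k)) /=; last first.
  by rewrite mem_imset // !inE eqxx.
congr (_ * _); apply: eq_bigl => i.
have [->|ik] := eqVneq i (col k); first by rewrite andbF imset_f.
rewrite andbT; congr (~~ _); apply/imsetP/imsetP => -[l Sl il].
  by exists l => //; move: Sl; rewrite inE => /andP[].
exists l => //; rewrite !inE Sl andbT.
by apply: contra ik => /eqP <-; apply/eqP.
Qed.

(** Inside S all coefficients vanish, so every term belongs either to a full row
    k in S, which is a multiple of dlog f_k /\ dlog (p+ / p-), or to a pair of
    inverted variables. *)
Lemma log_form_independent (S : {set J}) :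
  (forall i j, i \in S -> j \in S -> ~~ (0 < B i (col j))) ->
  reg_loc gen (prod_off S) log_form.
Proof.
move=> indep.
have B0 i j : i \in S -> j \in S -> B i (col j) = 0.
  move=> Si Sj; have := indep _ _ Si Sj; rewrite -leNgt le_eqVlt.
  by case/predU1P => // /B_sign; rewrite (negbTE (indep _ _ Sj Si)).
pose P i := i \in col @: S.
have W0 i j : P i -> P j -> (W i j)%:~R = 0 :> K.
  move=> /imsetP[k Sk ->] /imsetP[l Sl ->]; have [c _ ->] := W_row k.
  by rewrite B0 // mulr0.
pose F i j : ext2 (kaehler iota) :=
  (W i j)%:~R *: wedge (dlog iota (f i)) (dlog iota (f j)).
have FC i j : F i j = F j i.
  by rewrite /F W_anti rmorphN /= wedgeC scalerN scaleNr opprK.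
have row_reg i : P i -> reg_loc gen (prod_off S) (\sum_j F i j).
  move=> /imsetP[k Sk ->{i}]; have [c ac Wk] := W_row k.
  have -> : \sum_j F (col k) j = c *: wedge (dlog iota (f (col k)))
      (dlog iota (mpos f (B k)) - dlog iota (mneg f (B k))).
    rewrite (logd_ratio _ (kd_derivation iota)) // wedge_sumr scaler_sumr.
    by apply: eq_bigr => j _; rewrite /F Wk wedgeZr scalerA.
  have locV a : (forall i, i \in col @: S -> a i = 0%N) ->
      alg_loc iota gen (prod_off S) (\prod_i f i ^+ a i)^-1.
    move=> a0; apply: alg_locV; last exact: dvd_prod_off_prod.
    by apply/prodf_neq0 => i _; rewrite expf_neq0.
  have locVp : alg_loc iota gen (prod_off S) (mpos f (B k))^-1.
    by apply: locV => _ /imsetP[l Sl ->]; rewrite B0.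
  have locVn : alg_loc iota gen (prod_off S) (mneg f (B k))^-1.
    by apply: locV => _ /imsetP[l Sl ->]; rewrite B0.
  have amneg : alg (mneg f (B k)) by apply: in_alg_prod => i _; apply: in_algX.
  apply: reg_locZ; first exact: alg_loc_alg.
  rewrite (exchange_wedge _ _ _ _ (exchange k)) ?mpos_neq0 ?mneg_neq0 //.
  rewrite -scaleNr -mulNr invfM.
  apply: (reg_locD (alg_prod_off S)); apply: reg_locZ => //.
  - exact/reg_loc_reg/regular_wedge.
  - apply: alg_locM; last exact: alg_locM.
    by rewrite -sub0r; apply/alg_loc_alg/in_algB/alg_f'; apply: (in_alg_int _ _ 0).
  - exact/reg_loc_reg/regular_wedge.
have F0 i j : P i -> P j -> F i j = 0 by move=> Pi Pj; rewrite /F W0 // scale0r.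
rewrite /log_form (sum_symmetric FC F0).
apply: (reg_locD (alg_prod_off S)); first exact: (reg_loc_sum (alg_prod_off S)).
apply: (reg_locD (alg_prod_off S)); first exact: (reg_loc_sum (alg_prod_off S)).
apply: (reg_loc_sum (alg_prod_off S)) => i Pi.
apply: (reg_loc_sum (alg_prod_off S)) => j Pj.
apply: reg_locZ; first exact/alg_loc_alg/in_alg_int.
rewrite wedge_dlog; apply: reg_locZ; last exact/reg_loc_reg/regular_wedge.
by apply: alg_locM; apply: alg_locV => //; apply: dvd_prod_off.
Qed.

(** Induction on S by removing one of two linked indices; the relation
    p- = f_i f_i' - p+ at a source i of the links inside S glues the two cases. *)
Lemma clears_prod_off (S : {set J}) : clears gen log_form (prod_off S).
Proof.
have [n] := ubnP #|S|; elim: n S => // n IH S /ltnSE leSn.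
(* A source of S' receives no edge from anywhere in S: such an edge would put its
   origin in S'. *)
pose S' := [set i in S | [exists j in S, 0 < B i (col j)]].
have [S'0 | [i0 S'i0]] := set_0Vmem S'.
  split; first exact: alg_prod_off.
  apply: log_form_independent => i j Si Sj; apply/negP => Bij.
  have : i \in S' by rewrite inE Si; apply/exists_inP; exists j.
  by rewrite S'0 inE.
have [i S'i src] := acyclic_source B_acyclic S'i0.
have [Si /exists_inP[j Sj Bij]] : i \in S /\ [exists j in S, 0 < B i (col j)].
  by move: S'i; rewrite inE => /andP.
have clears_at k : k \in S -> clears gen log_form (prod_off S * f (col k)).
  move=> Sk; rewrite -prod_offD1 //; apply: IH.
  by move: leSn; rewrite (cardsD1 k) Sk.
have no_in l : l \in S -> zpos (- B i (col l)) = 0%N.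
  move=> Sl; case: (ltrP (B i (col l)) 0) => [/B_sign Bli | ].
    have : l \in S' by rewrite inE Sl; apply/exists_inP; exists i.
    by move=> /src; rewrite Bli.
  by case: (B i (col l)) => [[]|].
(* p- divides a power of the inverted product, so it may be cleared as well. *)
apply: (@clears_dvd _ _ _ _ _ _ (mneg f (B i))) => //; last first.
  by apply: dvd_prod_off_prod => _ /imsetP[l Sl ->]; apply: no_in.
have -> : mneg f (B i) = f (col i) * f' i - mpos f (B i).
  by rewrite exchange addrAC subrr add0r.
have -> : mpos f (B i) = f (col j) * (f (col j) ^+ (zpos (B i (col j))).-1
    * \prod_(l | l != col j) f l ^+ zpos (B i l)).
  rewrite /mpos (bigD1 (col j)) //= mulrA -exprS prednK //.
  by case: (B i (col j)) Bij.
set g := _ * \prod_(_ | _) _.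
have -> : prod_off S * (f (col i) * f' i - f (col j) * g)
    = prod_off S * f (col i) * f' i + prod_off S * f (col j) * (0 - g) by ring.
apply: clearsD; apply: clearsM => //; [exact: clears_at | exact: clears_at | ].
apply: in_algB; first exact: (in_alg_int _ _ 0).
apply: in_algM; first exact: in_algX.
by apply: in_alg_prod => l _; apply: in_algX.
Qed.

Theorem log_form_regular : reg log_form.
Proof.
have [_ [N reg_uN]] := clears_prod_off setT.
rewrite -[log_form]scale1r -(mulVf (_ : prod_off setT ^+ N != 0)); last first.
  by rewrite expf_neq0 //; apply/prodf_neq0.
rewrite -scalerA -exprVn -prodfV; apply: regularZ => //.
apply: in_algX; apply: in_alg_prod => i Ti; apply: alg_fV.
apply: contra Ti => /codomP[k ->]; exact: imset_f.
Qed.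

End AcyclicCluster.

(** * Mutation of clusters *)

Section Mutation.
Variables (C : numFieldType) (K : fieldType) (iota : {rmorphism C -> K}).
Variables (I : finType) (k : I) (b : I -> int) (f : I -> K).
Hypothesis b_k : b k = 0.
Hypothesis f_neq0 : forall i, f i != 0.

Lemma intr_K_eq0 (z : int) : (z%:~R == 0 :> K) = (z == 0).
Proof. by rewrite -(rmorph_int iota) fmorph_eq0 intr_eq0. Qed.

Definition exch_poly : K := mpos f b + mneg f b.
Definition mutated (i : I) : K := if i == k then (f k)^-1 * exch_poly else f i.
Definition exch_ratio : K := mpos f b / exch_poly.

(** The coefficients of dlog (p+ + p-): this is p+ / (p+ + p-) times dlog p+ plus
    p- / (p+ + p-) times dlog p-, that is dlog p- plus the ratio times
    dlog (p+ / p-). *)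
Definition log_coef (i : I) : K :=
  (zpos (- b i))%:R + (b i)%:~R * exch_ratio.

Lemma log_coef_k : log_coef k = 0.
Proof. by rewrite /log_coef b_k oppr0 mul0r addr0. Qed.

Section ExchPoly.
Hypothesis exch_poly_neq0 : exch_poly != 0.

Lemma logd_exch_poly (N : lmodType K) (D : K -> N) : derivation iota D ->
  logd D exch_poly = logd D (mneg f b)
    + exch_ratio *: (logd D (mpos f b) - logd D (mneg f b)).
Proof.
move=> hD; have [dD _ _] := hD.
rewrite {1}/logd /exch_poly dD (derivationE D (mpos_neq0 _ f_neq0)).
rewrite (derivationE D (mneg_neq0 _ f_neq0)).
move: (logd D (mpos f b)) (logd D (mneg f b)) => u v.
rewrite -/exch_poly scalerDr !scalerA.
have -> : exch_poly^-1 * mneg f b = 1 - exch_ratio.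
  rewrite /exch_ratio -(divff exch_poly_neq0) -mulrBl mulrC; congr (_ / _).
  by rewrite /exch_poly addrAC subrr add0r.
by rewrite [_^-1 * _]mulrC scalerBl scale1r scalerBr addrCA.
Qed.

Lemma logd_mutated (N : lmodType K) (D : K -> N) : derivation iota D ->
  logd D (mutated k) = - logd D (f k) + \sum_i log_coef i *: logd D (f i).
Proof.
move=> hD; rewrite /mutated eqxx (logdM hD) ?invr_eq0 // (logdV hD) //.
rewrite logd_exch_poly // (logd_ratio _ hD) // (logd_prod hD) // scaler_sumr.
rewrite -big_split; congr (_ + _); apply: eq_bigr => i _ /=.
move: (logd D _) => u.
by rewrite scalerDl scalerA [_ * exch_ratio]mulrC.
Qed.

Lemma dlog_mutated : dlog iota (mutated k)
  = - dlog iota (f k) + \sum_i log_coef i *: dlog iota (f i).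
Proof. exact/logd_mutated/kd_derivation. Qed.

Lemma mutated_neq0 i : mutated i != 0.
Proof.
rewrite /mutated; case: ifP => _; last exact: f_neq0.
by apply: mulf_neq0; rewrite ?invr_eq0.
Qed.

Lemma exch_ratio_neq1 : 1 - exch_ratio != 0.
Proof.
rewrite /exch_ratio -(divff exch_poly_neq0) -mulrBl mulf_neq0 ?invr_eq0 //.
by rewrite /exch_poly addrAC subrr add0r mneg_neq0.
Qed.

Variables (W : I -> I -> int) (c : int).
Hypothesis W_anti : forall i j, W i j = - W j i.
Hypothesis W_k : forall j, W k j = c * b j.

(** On mutable rows this agrees with the mutation of the exchange matrix
    ([mutated_coef_row]); on pairs of frozen indices it is the correction that
    makes the mutation of forms exact. *)
Definition mutated_coef (i j : I) : int :=
  if (i == k) || (j == k) then - W i j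
  else W i j + c * ((zpos (- b i))%:Z * b j - (zpos (- b j))%:Z * b i).

Lemma mutated_coef_anti i j : mutated_coef i j = - mutated_coef j i.
Proof.
rewrite /mutated_coef orbC [in LHS]W_anti.
by case: ifP => _; last ring.
Qed.

Lemma wedge_sym (M : lmodType K) (V : I -> I -> int) (u : I -> M) :
  (forall i j, V i j = - V j i) -> forall i j,
  (V i j)%:~R *: wedge (u i) (u j) = (V j i)%:~R *: wedge (u j) (u i) :> ext2 M.
Proof.
by move=> V_anti i j; rewrite V_anti rmorphN /= wedgeC scalerN scaleNr opprK.
Qed.

(** Write th = dlog (p+ / p-) and nn = dlog p-.  Row k of W is c th, and
    e'_k = - e_k + nn + h th, so the terms containing k change by - 2 c nn /\ th:
    the part with the non-constant ratio h disappears because th /\ th = 0.  The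
    correction in [mutated_coef] is exactly 2 c nn /\ th. *)
Lemma wedge_form_mutated (M : lmodType K) (e e' : I -> M) :
  e' k = - e k + \sum_i log_coef i *: e i ->
  (forall i, i != k -> e' i = e i) ->
  \sum_i \sum_j (mutated_coef i j)%:~R *: wedge (e' i) (e' j)
  = \sum_i \sum_j (W i j)%:~R *: wedge (e i) (e j).
Proof.
move=> e'_k e'_i.
pose th := \sum_i (b i)%:~R *: e i; pose nn := \sum_i (zpos (- b i))%:R *: e i.
have split_k (V : I -> I -> int) (g : I -> M) : (forall i j, V i j = - V j i) ->
    \sum_i \sum_j (V i j)%:~R *: wedge (g i) (g j)
    = (\sum_j (V k j)%:~R *: wedge (g k) (g j)) *+ 2
    + \sum_(i | i != k) \sum_(j | j != k) (V i j)%:~R *: wedge (g i) (g j).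
  move=> V_anti; rewrite (sum_symmetric (P := pred1 k)).
  - by rewrite !big_pred1_eq addrA mulr2n.
  - exact: wedge_sym.
  - by move=> i j /eqP -> /eqP ->; rewrite wedge_alt scaler0.
rewrite !split_k //; last exact: mutated_coef_anti.
have W_th u : \sum_j (W k j)%:~R *: wedge u (e j) = c%:~R *: wedge u th.
  rewrite wedge_sumr scaler_sumr; apply: eq_bigr => j _.
  by rewrite W_k rmorphM /= wedgeZr scalerA.
have e_k' : e' k = - e k + (nn + exch_ratio *: th).
  rewrite e'_k scaler_sumr -big_split; congr (_ + _); apply: eq_bigr => i _ /=.
  by rewrite scalerDl [_ * exch_ratio]mulrC [X in _ = _ + X]scalerA.
have W_k0 : W k k = 0 by rewrite W_k b_k mulr0.
have row_k : \sum_j (mutated_coef k j)%:~R *: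
      wedge (e' k) (e' j)
    = c%:~R *: wedge (e k) th - c%:~R *: wedge nn th.
  rewrite -scalerBr.
  have -> : wedge (e k) th - wedge nn th = - wedge (e' k) th.
    rewrite e_k' !wedgeDl wedgeNl wedgeZl wedge_alt scaler0 addr0.
    by rewrite opprD opprK.
  rewrite scalerN -W_th -sumrN; apply: eq_bigr => j _.
  rewrite -scaleNr /mutated_coef eqxx /= rmorphN /=.
  have [->|jk] := eqVneq j k; first by rewrite W_k0 oppr0 !scale0r.
  by rewrite (e'_i j jk).
rewrite row_k.
have wedge_nn_th x y : wedge (\sum_i (x i)%:~R *: e i) (\sum_i (y i)%:~R *: e i)
    = \sum_i \sum_j (x i * y j)%:~R *: wedge (e i) (e j).
  rewrite wedge_suml; apply: eq_bigr => i _; rewrite wedge_sumr.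
  by apply: eq_bigr => j _; rewrite wedgeZl wedgeZr scalerA -rmorphM.
have nn_th : (c%:~R *: wedge nn th) *+ 2
    = \sum_(i | i != k) \sum_(j | j != k) (c * ((zpos (- b i))%:Z * b j
          - (zpos (- b j))%:Z * b i))%:~R *: wedge (e i) (e j).
  transitivity (\sum_i \sum_j (c * ((zpos (- b i))%:Z * b j
          - (zpos (- b j))%:Z * b i))%:~R *: wedge (e i) (e j)).
    rewrite mulr2n -scalerDr {2}[wedge nn th]wedgeC.
    rewrite (wedge_nn_th (fun i => (zpos (- b i))%:Z) b).
    rewrite (wedge_nn_th b (fun i => (zpos (- b i))%:Z)) -sumrB.
    rewrite scaler_sumr; apply: eq_bigr => i _.
    rewrite -sumrB scaler_sumr; apply: eq_bigr => j _.
    by rewrite -scalerBl scalerA -rmorphB -rmorphM [b i * _]mulrC.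
  rewrite (bigD1 k) //= big1 ?add0r => [|j _]; last first.
    by rewrite b_k oppr0 !mul0r mulr0 subrr mulr0 scale0r.
  apply: eq_bigr => i _; rewrite (bigD1 k) //= b_k oppr0 mul0r mulr0 subrr.
  by rewrite mulr0 scale0r add0r.
rewrite W_th mulrnBl -addrA; congr (_ + _); rewrite addrC; apply/eqP.
rewrite subr_eq addrC nn_th -big_split /=; apply/eqP; apply: eq_bigr => i ik.
rewrite -big_split /=; apply: eq_bigr => j jk.
rewrite -scalerDl -rmorphD /mutated_coef (negbTE ik) (negbTE jk) /= !e'_i //.
by rewrite addrC.
Qed.

Lemma log_form_mutated : log_form iota mutated mutated_coef = log_form iota f W.
Proof.
apply: wedge_form_mutated; first exact: dlog_mutated.
by move=> i /negbTE ik; rewrite /mutated ik.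
Qed.

End ExchPoly.
End Mutation.

(** * Evaluating two-forms on pairs of derivations *)

Section Pairing.
Variables (C K : fieldType) (iota : {rmorphism C -> K}).
Variables (D1 D2 : K -> K^o).
Hypotheses (hD1 : derivation iota D1) (hD2 : derivation iota D2).

Let L1 := kaehler_lift (iota := iota) D1.
Let L2 := kaehler_lift (iota := iota) D2.

(** The value of a two-form on the pair of vector fields D1, D2. *)
Definition pairing : ext2 (kaehler iota) -> K^o :=
  ext2_lift (fun u v => L1 u * L2 v - L1 v * L2 u : K^o).

Lemma pairing_alternating :
  alternating (fun u v => L1 u * L2 v - L1 v * L2 u : K^o).
Proof.
have l1 := kaehler_lift_linear hD1; have l2 := kaehler_lift_linear hD2.
split=> [a u u' v|a u v v'|u]; last by rewrite subrr.
  by rewrite /L1 /L2 l1 l2 /GRing.scale /=; ring.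
by rewrite /L1 /L2 l1 l2 /GRing.scale /=; ring.
Qed.

Fact pairing_linear : linear pairing.
Proof. exact: ext2_lift_linear pairing_alternating. Qed.

HB.instance Definition _ :=
  GRing.isLinear.Build K (ext2 (kaehler iota)) K^o _ pairing pairing_linear.

Lemma pairing_dlog x y : pairing (wedge (dlog iota x) (dlog iota y))
  = logd D1 x * logd D2 y - logd D1 y * logd D2 x.
Proof.
rewrite /pairing ext2_lift_wedge; last exact: pairing_alternating.
have dlogE (D : K -> K^o) z :
    derivation iota D -> kaehler_lift D (dlog iota z) = logd D z.
  move=> hD; have lD := kaehler_lift_linear hD.
  have lD0 : kaehler_lift (iota := iota) D 0 = 0.
    by have := lD (-1) 0 0; rewrite scaler0 addr0 scaleN1r addNr.
  rewrite /dlog /logd -[_ *: kd _ _]addr0 lD lD0 addr0.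
  by rewrite (kaehler_lift_d _ hD).
by rewrite /L1 /L2 !dlogE.
Qed.

Lemma pairing_log_form (I : finType) (f : I -> K) (W : I -> I -> int) :
  (forall i j, W i j = - W j i) ->
  pairing (log_form iota f W)
  = 2 * \sum_i \sum_j (W i j)%:~R * (logd D1 (f i) * logd D2 (f j)).
Proof.
move=> W_anti; rewrite linear_sum.
have -> : \sum_i pairing (
      \sum_j (W i j)%:~R *: wedge (dlog iota (f i)) (dlog iota (f j)))
  = \sum_i \sum_j (W i j)%:~R * (logd D1 (f i) * logd D2 (f j))
    + \sum_i \sum_j (W j i)%:~R * (logd D1 (f j) * logd D2 (f i)).
  rewrite -big_split; apply: eq_bigr => i _ /=.
  rewrite linear_sum -big_split; apply: eq_bigr => j _ /=.
  rewrite linearZ_LR /= pairing_dlog [W j i]W_anti rmorphN /=.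
  by rewrite /GRing.scale /=; ring.
by rewrite [X in _ + X]exchange_big /= mulr_natl mulr2n.
Qed.

End Pairing.

(** * Logarithmic frames *)

Section Frame.
Variables (C : numFieldType) (K : fieldType) (iota : {rmorphism C -> K}).
Variables (I : finType).

(** Derivations dual to the logarithms of f.  Their existence expresses that the
    forms dlog f_i are linearly independent. *)
Definition log_frame (f : I -> K) (D : I -> K -> K^o) : Prop :=
  (forall i, derivation iota (D i))
  /\ (forall i j, logd (D i) (f j) = (i == j)%:R).

Variables (k : I) (b : I -> int) (f : I -> K) (D : I -> K -> K^o).
Hypothesis b_k : b k = 0.
Hypothesis f_neq0 : forall i, f i != 0.
Hypothesis f_frame : log_frame f D.

Let hD i : derivation iota (D i). Proof. by case: f_frame. Qed.
Let logD i j : logd (D i) (f j) = (i == j)%:R. Proof. by case: f_frame. Qed.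

Let sum_logD i (c : I -> K) : \sum_j c j *: logd (D i) (f j) = c i.
Proof.
rewrite (bigD1 i) //= logD eqxx big1 ?addr0 => [|j ji].
  exact: mulr1.
by rewrite logD eq_sym (negbTE ji) scaler0.
Qed.

(** If p+ = - p-, then p+ and p- have equal logarithmic derivatives, so the frame
    reads off that the row b vanishes; but then p+ + p- = 1 + 1. *)
Lemma frame_exch_poly_neq0 : exch_poly b f != 0.
Proof.
apply/eqP => p0; have eq_pn : mpos f b = - mneg f b.
  by apply/eqP; rewrite -addr_eq0; apply/eqP.
have b0 i : b i = 0.
  apply/eqP; rewrite -(intr_K_eq0 iota) -(sum_logD i (fun j => (b j)%:~R)).
  rewrite -(logd_ratio _ (hD i)) // eq_pn subr_eq0; apply/eqP.
  have [dD _ _] := hD i; rewrite /logd.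
  have -> : D i (- mneg f b) = - D i (mneg f b).
    by apply/eqP; rewrite -addr_eq0 -dD addNr (derivation0 (hD i)).
  by rewrite invrN scaleNr scalerN opprK.
move/eqP: p0; rewrite /exch_poly /mpos /mneg.
rewrite !big1 => [|i _|i _]; rewrite ?b0 //.
by rewrite -[1 + 1]/(2%:~R) (intr_K_eq0 iota).
Qed.

Local Notation f' := (mutated k b f).
Local Notation g := (log_coef b f).

Let logD_k i : logd (D i) (f' k) = g i - (i == k)%:R.
Proof.
rewrite (logd_mutated _ f_neq0 frame_exch_poly_neq0 (hD i)) sum_logD logD.
by rewrite addrC.
Qed.

(** The base change dual to e'_k = - e_k + sum of g_i e_i. *)
Definition mutated_frame (i : I) (x : K) : K^o :=
  if i == k then - D k x else D i x + g i * D k x.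

Lemma mutated_frame_derivation i : derivation iota (mutated_frame i).
Proof.
rewrite /mutated_frame.
case: (hD i) (hD k) => [dD dM dC] [dDk dMk dCk].
case: (i == k).
  split=> [x y|x y|c]; first by rewrite dDk opprD.
    by rewrite dMk /GRing.scale /=; ring.
  by rewrite dCk oppr0.
split=> [x y|x y|c]; first by rewrite dD dDk mulrDr addrACA.
  by rewrite dM dMk /GRing.scale /=; ring.
by rewrite dC dCk mulr0 addr0.
Qed.

Lemma logd_mutated_frame i x : logd (mutated_frame i) x =
  if i == k then - logd (D k) x else logd (D i) x + g i * logd (D k) x.
Proof.
by rewrite /logd /mutated_frame /GRing.scale /=; case: ifP => _; ring.
Qed.

Lemma log_frame_mutated : log_frame f' mutated_frame.
Proof.
split=> [|i j]; first exact: mutated_frame_derivation.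
rewrite logd_mutated_frame; have [->|jk] := eqVneq j k.
  rewrite !logD_k log_coef_k // eqxx sub0r opprK.
  by case: eqVneq => // _; rewrite mulrN1 subr0 subrr.
rewrite /mutated (negbTE jk) !logD [k == j]eq_sym (negbTE jk) oppr0 mulr0 addr0.
by case: eqVneq => // ->; rewrite eq_sym (negbTE jk).
Qed.

(** Evaluated on the pair (i, j) of the mutated frame, the equality of forms reads
    W' i j = W i j + g_j W i k + g_i W k j, where g_i = [- b_i]_+ + b_i h.  The
    coefficient m of the ratio h must vanish, because otherwise h would be the
    constant z / m; its logarithmic derivatives (1 - h) b_l would then be zero,
    hence the row b too, and m with it. *)
Lemma mutation_invariant_proportional (W W' : I -> I -> int) :
  (forall i j, W i j = - W j i) -> (forall i j, W' i j = - W' j i) ->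
  log_form iota f W = log_form iota f' W' ->
  forall i j, b i * W k j = b j * W k i.
Proof.
move=> W_anti W'_anti eqW.
have W_kk : W k k = 0 by have := W_anti k k; lia.
have two0 : 2 != 0 :> K by rewrite (intr_K_eq0 iota 2).
suff in_neq i j : i != k -> j != k -> b i * W k j = b j * W k i.
  move=> i j; have [->|ik] := eqVneq i k; first by rewrite b_k W_kk mul0r mulr0.
  have [->|jk] := eqVneq j k; first by rewrite b_k W_kk mul0r mulr0.
  exact: in_neq.
move=> ik jk; set m := b i * W k j - b j * W k i.
have sum_delta (F : I -> K) (a : I) (x : K) :
    \sum_c F c * ((a == c)%:R + x * (k == c)%:R) = F a + x * F k.
  have pick a' : \sum_c F c * (a' == c)%:R = F a'.
    rewrite (bigD1 a') //= eqxx mulr1 big1 ?addr0 // => c ca'.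
    by rewrite eq_sym (negbTE ca') mulr0.
  under eq_bigr => c _ do rewrite mulrDr mulrCA.
  by rewrite big_split -mulr_sumr /= !pick.
have pair_old : \sum_a \sum_c (W a c)%:~R *
      (logd (mutated_frame i) (f a) * logd (mutated_frame j) (f c) : K)
    = (W i j)%:~R + g j * (W i k)%:~R + g i * (W k j)%:~R.
  under eq_bigr => a _.
    under eq_bigr => c _.
      rewrite !logd_mutated_frame (negbTE ik) (negbTE jk) !logD mulrCA mulrC.
      over.
    rewrite -mulr_suml sum_delta.
    over.
  by rewrite sum_delta W_kk; ring.
have pair_new : \sum_a \sum_c (W' a c)%:~R *
    (logd (mutated_frame i) (f' a) * logd (mutated_frame j) (f' c) : K)
    = (W' i j)%:~R.
  have [_ lf'] := log_frame_mutated.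
  rewrite (bigD1 i) //= (bigD1 j) //= !lf' !eqxx !mulr1 big1 ?addr0; last first.
    by move=> c cj; rewrite !lf' [j == c]eq_sym (negbTE cj) !mulr0.
  rewrite big1 ?addr0 // => a ai; rewrite big1 // => c _.
  by rewrite lf' eq_sym (negbTE ai) mul0r mulr0.
have hi := mutated_frame_derivation i; have hj := mutated_frame_derivation j.
have := pairing_log_form hi hj f W_anti; rewrite eqW (pairing_log_form hi hj) //.
move/(mulfI two0); rewrite pair_new pair_old => eq_ij.
(* The part of the equality that does not contain the ratio. *)
pose z := W' i j - W i j + (zpos (- b j))%:Z * W k i - (zpos (- b i))%:Z * W k j.
have mz : m%:~R * exch_ratio b f = z%:~R.
  rewrite /m /z !(rmorphD, rmorphN, rmorphM) /= eq_ij [W i k]W_anti.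
  by rewrite rmorphN /= /log_coef; ring.
apply/eqP; rewrite -subr_eq0 -/m; apply: contraT => m0.
suff b0 l : b l = 0 by move: m0; rewrite /m !b0 !mul0r subrr eqxx.
have p0 := frame_exch_poly_neq0.
have Dratio : D l (exch_ratio b f) = 0.
  have [_ dM dC] := hD l; have := dM m%:~R (exch_ratio b f).
  rewrite mz -!(rmorph_int iota) !dC scaler0 addr0 => /esym/eqP.
  by rewrite scaler_eq0 (rmorph_int iota) (intr_K_eq0 iota) (negbTE m0) => /eqP.
have := logdM (hD l) (mpos_neq0 b f_neq0) (_ : (exch_poly b f)^-1 != 0).
rewrite invr_eq0 => /(_ p0); rewrite -/(exch_ratio b f) {1}/logd Dratio scaler0.
rewrite (logdV (hD l)) // (logd_exch_poly f_neq0 p0 (hD l)) opprD addrA.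
rewrite -{1}[logd _ _ - _]scale1r -scalerBl (logd_ratio _ (hD l)) // sum_logD.
move=> /esym/eqP; rewrite scaler_eq0 (negbTE (exch_ratio_neq1 f_neq0 p0)) /=.
by rewrite (intr_K_eq0 iota) => /eqP.
Qed.

End Frame.

(** * Derivations of a fraction field *)

Section FractionDerivation.
Variables (R : idomainType) (del : R -> R).
Hypothesis delD : forall p q, del (p + q) = del p + del q.
Hypothesis delM : forall p q, del (p * q) = p * del q + q * del p.
Local Notation "p %:F" := (@FracField.tofrac R p).

(** The quotient rule in the form D x = (del p - x del q) / q for x = p / q, with
    p / q the chosen representative of x. *)
Definition frac_der (x : {fraction R}) : {fraction R} :=
  let r := generic_quotient.repr x in
  ((del \n_r)%:F - x * (del \d_r)%:F) / (\d_r)%:F.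

Lemma frac_numden (x : {fraction R}) :
  x * (\d_(generic_quotient.repr x))%:F = (\n_(generic_quotient.repr x))%:F.
Proof.
set r := generic_quotient.repr x; rewrite -[in LHS](generic_quotient.reprK x) -/r.
unlock FracField.tofrac; rewrite -[LHS]FracField.pi_mul; apply/eqP.
rewrite FracField.equivf_def /FracField.mulf /=.
by rewrite !numden_Ratio ?mulf_neq0 ?oner_neq0 ?denom_ratioP // !mulr1 mulrC.
Qed.

(** Independence of the representative: apply del to the relation between two
    fractions that represent x. *)
Lemma frac_derP (x : {fraction R}) p q : q != 0 -> x * q%:F = p%:F ->
  frac_der x * q%:F = (del p)%:F - x * (del q)%:F.
Proof.
move=> q0 xq; have xd := frac_numden x; rewrite /frac_der.
have d0 : (\d_(generic_quotient.repr x))%:F != 0.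
  by rewrite tofrac_eq0 denom_ratioP.
move: (\n_ _) (\d_ _) xd d0 => n d xd d0.
apply: (mulIf d0); rewrite mulrAC divfK //.
have : n * q = p * d.
  by apply/eqP; rewrite -tofrac_eq !tofracM -xd -xq; apply/eqP; ring.
move/(congr1 del)/(congr1 (@FracField.tofrac R)); rewrite !delM.
rewrite !tofracD !tofracM -xd -xq => eq_del.
apply/eqP; rewrite -subr_eq0; apply/eqP.
rewrite -[RHS](subrr (x * q%:F * (del d)%:F + d%:F * (del p)%:F)) -{1}eq_del.
by ring.
Qed.

Lemma frac_derE (x y : {fraction R}) p q : q != 0 -> x * q%:F = p%:F ->
  y * q%:F = (del p)%:F - x * (del q)%:F -> frac_der x = y.
Proof.
move=> q0 xq yq; apply: (@mulIf _ q%:F); first by rewrite tofrac_eq0.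
by rewrite yq; apply: frac_derP.
Qed.

Let del1 : del 1 = 0.
Proof.
have := delM 1 1; rewrite !mul1r => e.
by apply: (addrI (del 1)); rewrite addr0 -e.
Qed.

Lemma frac_der_tofrac p : frac_der p%:F = (del p)%:F.
Proof.
apply: (@frac_derE _ _ p 1); rewrite ?oner_neq0 // tofrac1 ?mulr1 //.
by rewrite del1 tofrac0 mulr0 subr0.
Qed.

Let frac_witness (x : {fraction R}) : exists p q, q != 0 /\ x * q%:F = p%:F.
Proof.
exists (\n_(generic_quotient.repr x)), (\d_(generic_quotient.repr x)).
by rewrite denom_ratioP frac_numden.
Qed.

Lemma frac_derD x y : frac_der (x + y) = frac_der x + frac_der y.
Proof.
have [p [q [q0 xq]]] := frac_witness x; have [p' [q' [q'0 yq]]] := frac_witness y.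
have Dx := frac_derP q0 xq; have Dy := frac_derP q'0 yq.
apply: (@frac_derE _ _ (p * q' + p' * q) (q * q')); first by rewrite mulf_neq0.
  by rewrite tofracD !tofracM -xq -yq; ring.
rewrite tofracM mulrDl {1}mulrA Dx [q%:F * _]mulrC {1}mulrA Dy.
by rewrite !delD !delM !tofracD !tofracM -xq -yq; ring.
Qed.

Lemma frac_derM x y : frac_der (x * y) = x * frac_der y + y * frac_der x.
Proof.
have [p [q [q0 xq]]] := frac_witness x; have [p' [q' [q'0 yq]]] := frac_witness y.
have Dx := frac_derP q0 xq; have Dy := frac_derP q'0 yq.
apply: (@frac_derE _ _ (p * p') (q * q')); first by rewrite mulf_neq0.
  by rewrite !tofracM -xq -yq; ring.
transitivity (x * q%:F * (frac_der y * q'%:F) + y * q'%:F * (frac_der x * q%:F)).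
  by rewrite tofracM; ring.
by rewrite Dx Dy !delM !tofracD !tofracM -xq -yq; ring.
Qed.

End FractionDerivation.

Section InitialFrame.
Variables (n : nat) (C : numFieldType).
Local Notation K := (ratfun n C).
Local Notation iota := (const_ratfun n C).

(** The operators x_i d/dx_i. *)
Definition euler (i : 'I_n) (p : {mpoly C[n]}) : {mpoly C[n]} := 'X_i * mderiv i p.

Definition euler_frame (i : 'I_n) : K -> K^o := frac_der (euler i).

Definition initial_cluster (i : 'I_n) : K := @FracField.tofrac {mpoly C[n]} 'X_i.

Let eulerD i p q : euler i (p + q) = euler i p + euler i q.
Proof. by rewrite /euler mderivD mulrDr. Qed.

Let eulerM i p q : euler i (p * q) = p * euler i q + q * euler i p.
Proof. by rewrite /euler mderivM; ring. Qed.

Lemma initial_cluster_neq0 i : initial_cluster i != 0.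
Proof. by rewrite /initial_cluster tofrac_eq0 -msupp_eq0 msuppX. Qed.

Lemma initial_log_frame : log_frame iota initial_cluster euler_frame.
Proof.
split=> [i|i j].
  split=> [x y|x y|c].
  - exact: (frac_derD (eulerD i) (eulerM i)).
  - exact: (frac_derM (eulerM i)).
  rewrite /euler_frame /= (frac_der_tofrac (eulerM i)).
  by rewrite /euler mderivC mulr0 tofrac0.
rewrite /logd /euler_frame (frac_der_tofrac (eulerM i)) /euler mderivX.
rewrite mnm1E eq_sym; case: eqVneq => [->|_]; last first.
  by rewrite scale0r mulr0 tofrac0 scaler0.
have -> : (U_(j) - U_(j))%MM = 0%MM by apply/mnmP => l; rewrite mnmBE subnn mnm0E.
by rewrite scale1r mpolyX0 mulr1; apply: mulVf (initial_cluster_neq0 j).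
Qed.

End InitialFrame.

(** * Seeds *)

Section AntisymmetricExtension.
Variables (m n : nat) (le_mn : (m <= n)%N).
Local Notation col := (widen_ord le_mn).
Implicit Types M : 'M[int]_(m, n).

Lemma col_inj : injective col.
Proof. by move=> i j /(congr1 val) /= ij; apply: val_inj. Qed.

Lemma frozenE (i : 'I_n) : (i \notin codom col) = (m <= i)%N.
Proof.
apply/idP/idP => [|le_mi]; last first.
  by apply/negP => /codomP[k ik]; move: le_mi; rewrite ik /= leqNgt ltn_ord.
rewrite leqNgt; apply: contra => lt_im.
by apply/codomP; exists (Ordinal lt_im); apply: val_inj.
Qed.

(** The entries above the diagonal of an m x n matrix, as an n x n matrix that is
    zero on frozen rows; the sum has at most one term. *)
Definition upper_part M (i j : 'I_n) : int :=
  \sum_(k < m | col k == i) if (i < j)%N then M k j else 0.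

Definition antisym_ext M (i j : 'I_n) : int := upper_part M i j - upper_part M j i.

Lemma antisym_ext_anti M i j : antisym_ext M i j = - antisym_ext M j i.
Proof. by rewrite /antisym_ext opprB. Qed.

Lemma upper_part_col M k j :
  upper_part M (col k) j = if (k < j)%N then M k j else 0.
Proof.
by rewrite /upper_part (big_pred1 k) // => l; rewrite (inj_eq col_inj).
Qed.

Lemma upper_part_frozen M i j : i \notin codom col -> upper_part M i j = 0.
Proof.
move=> Fi; rewrite /upper_part big_pred0 // => k.
by apply: contraNF Fi => /eqP <-; apply: codom_f.
Qed.

Definition mutable_antisym M := forall k l, M k (col l) = - M l (col k).

Lemma antisym_ext_col M k j : mutable_antisym M -> antisym_ext M (col k) j = M k j.
Proof.
move=> M_anti; rewrite /antisym_ext upper_part_col.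
have [/codomP[l ->]|jF] := boolP (j \in codom col); last first.
  rewrite upper_part_frozen // subr0 ifT //.
  by move: jF; rewrite frozenE; apply: leq_trans.
rewrite upper_part_col /=; case: ltngtP => [_|_|/val_inj ->].
- by rewrite subr0.
- by rewrite sub0r -M_anti.
by have := M_anti l l; rewrite subrr; lia.
Qed.

(** The form of a cluster in an arbitrary field, so that the computations below
    do not unfold the concrete field of rational functions. *)
Definition upper_form (C K : fieldType) (iota : {rmorphism C -> K}) M
    (f : 'I_n -> K) : ext2 (kaehler iota) :=
  \sum_(i < m) \sum_(j < n | (i < j)%N) ((M i j)%:~R / (f (col i) * f j))
    *: wedge (kd iota (f (col i))) (kd iota (f j)).

(** The form that the sum over i < j defines sees only the entries above the
    diagonal, hence equals the one of their antisymmetric extension. *)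
Lemma upper_form_log_form (C K : fieldType) (iota : {rmorphism C -> K}) M
    (f : 'I_n -> K) :
  upper_form iota M f *+ 2 = log_form iota f (antisym_ext M).
Proof.
pose F i j := wedge (dlog iota (f i)) (dlog iota (f j)).
rewrite /upper_form.
set lhs := (X in X *+ 2).
have -> : lhs = \sum_i \sum_j (upper_part M i j)%:~R *: F i j.
  rewrite /lhs (partition_big col predT) //=; apply: eq_bigr => i _.
  transitivity (\sum_(k < m | col k == i) \sum_(j < n)
      (if (i < j)%N then M k j else 0)%:~R *: F i j).
    apply: eq_bigr => k /eqP <-; rewrite big_mkcond; apply: eq_bigr => j _ /=.
    case: ifP => _; last by rewrite scale0r.
    by rewrite /F wedge_dlog scalerA invfM.
  rewrite exchange_big; apply: eq_bigr => j _ /=.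
  by rewrite -scaler_suml /upper_part rmorph_sum.
rewrite /log_form mulr2n {2}exchange_big -big_split; apply: eq_bigr => i _ /=.
rewrite -big_split; apply: eq_bigr => j _ /=.
by rewrite /antisym_ext rmorphB scalerBl /F [in X in _ + X = _]wedgeC scalerN.
Qed.

Lemma wp_formE (C : numFieldType) M (f : 'I_n -> ratfun n C) :
  wp_form le_mn M f = upper_form (const_ratfun n C) M f.
Proof. reflexivity. Qed.

End AntisymmetricExtension.

Section ScaledRows.
Variables (m n : nat) (le_mn : (m <= n)%N).
Local Notation col := (widen_ord le_mn).
Implicit Types (B : 'M[int]_(m, n)) (D : 'M[int]_m).

Lemma mul_diagE D B k j : is_diag_mx D -> (D *m B) k j = D k k * B k j.
Proof.
move=> /is_diag_mxP D_diag; rewrite mxE (bigD1 k) //= big1 ?addr0 // => l lk.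
by rewrite D_diag ?mul0r // eq_sym.
Qed.

Lemma symmetrizer_antisym D B : symmetrizer le_mn D B ->
  mutable_antisym le_mn (D *m B).
Proof.
by case=> _ _ /matrixP DB_anti k l; have := DB_anti l k; rewrite !mxE.
Qed.

Lemma zpos_pmul (d z : int) : 0 < d -> (zpos (d * z))%:Z = d * (zpos z)%:Z.
Proof.
case: d => // d d0; case: z => [z|z] //=; rewrite mulr0.
by case: d d0 => // d _.
Qed.

(** The numerator is twice the right-hand side, so the integer division is
    exact. *)
Lemma mutate_entry (x y : int) :
  ((`|x| * y + x * `|y|) %/ 2)%Z
  = (zpos x)%:Z * (zpos y)%:Z - (zpos (- x))%:Z * (zpos (- y))%:Z.
Proof.
have absE z : `|z| = (zpos z)%:Z + (zpos (- z))%:Z :> int.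
  by case: z => [[|z]|z]; rewrite ?addr0 ?add0r.
have -> : `|x| * y + x * `|y|
    = ((zpos x)%:Z * (zpos y)%:Z - (zpos (- x))%:Z * (zpos (- y))%:Z) * 2.
  rewrite !absE; move: (zposB x) (zposB y).
  move: (zpos x)%:Z (zpos (- x))%:Z (zpos y)%:Z (zpos (- y))%:Z => a a' b b'.
  by move=> <- <-; ring.
by rewrite mulzK.
Qed.

Variables (D : 'M[int]_m) (B : 'M[int]_(m, n)) (W : 'I_n -> 'I_n -> int).
Hypothesis D_gt0 : forall k, 0 < D k k.
Hypothesis W_anti : forall i j, W i j = - W j i.
Hypothesis W_row : forall k j, W (col k) j = D k k * B k j.

Lemma row_diag k : B k (col k) = 0.
Proof.
have Wkk : W (col k) (col k) = 0 by have := W_anti (col k) (col k); lia.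
by move: Wkk; rewrite W_row => /eqP; rewrite mulf_eq0 gt_eqF //= => /eqP.
Qed.

Lemma row_swap k l : D k k * B k (col l) = - (D l l * B l (col k)).
Proof. by rewrite -!W_row. Qed.

Lemma row_sign k l : B k (col l) < 0 -> 0 < B l (col k).
Proof.
move=> Bkl; have := row_swap k l; have := D_gt0 k; have := D_gt0 l; nia.
Qed.

Lemma row_zero k l : B k (col l) = 0 -> B l (col k) = 0.
Proof.
move=> Bkl; have := row_swap l k; rewrite Bkl mulr0 oppr0 => /eqP.
by rewrite mulf_eq0 gt_eqF //= => /eqP.
Qed.

(** Symmetrizability turns the column entry D_l B_lk into - D_k B_kl, so that the
    mutation of row l is expressed through row k alone. *)
Lemma mutated_coef_row k l j :
  mutated_coef (col k) (B k) W (D k k) (col l) j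
  = D l l * mutate_mx le_mn k B l j.
Proof.
rewrite /mutated_coef mxE (inj_eq (col_inj (le_mn := le_mn))) W_row.
case: ifP => _; first by rewrite mulrN.
rewrite mutate_entry [RHS]mulrDr; congr (_ + _).
have swap : D l l * B l (col k) = D k k * - B k (col l).
  by rewrite row_swap mulrN.
have swap_pos : D l l * (zpos (B l (col k)))%:Z = D k k * (zpos (- B k (col l)))%:Z.
  by rewrite -!zpos_pmul // swap.
have swap_neg : D l l * (zpos (- B l (col k)))%:Z = D k k * (zpos (B k (col l)))%:Z.
  by rewrite -!zpos_pmul // mulrN swap mulrN opprK.
rewrite [RHS]mulrBr ![in RHS]mulrA swap_pos swap_neg.
move: (zposB (B k j)) (zposB (B k (col l))).
move: (zpos (B k j))%:Z (zpos (- B k j))%:Z => a a'.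
move: (zpos (B k (col l)))%:Z (zpos (- B k (col l)))%:Z => b b'.
by move=> <- <-; ring.
Qed.

Lemma antisym_ext_scaled k j : is_diag_mx D ->
  antisym_ext le_mn (D *m B) (col k) j = W (col k) j.
Proof.
move=> D_diag; rewrite W_row antisym_ext_col ?mul_diagE // => k' l.
by rewrite !mul_diagE // -!W_row.
Qed.

Lemma scaled_row_scalar (C K : fieldType) (iota : {rmorphism C -> K}) k :
  exists c : C, forall j, (W (col k) j)%:~R = iota c * (B k j)%:~R.
Proof. by exists (D k k)%:~R => j; rewrite W_row rmorphM /= rmorph_int. Qed.

End ScaledRows.

(** * Invariants of seeds and the theorem *)

Section Seeds.
Variables (C : numFieldType) (K : fieldType) (iota : {rmorphism C -> K}).
Variables (m n : nat) (le_mn : (m <= n)%N).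
Local Notation col := (widen_ord le_mn).
Implicit Types (B : 'M[int]_(m, n)) (f : 'I_n -> K).

Section Invariant.
Variables (D : 'M[int]_m) (x0 : 'I_n -> K) (w0 : ext2 (kaehler iota)).
Hypothesis D_gt0 : forall k, 0 < D k k.

(** The seed carries the form w0 with coefficients that extend D B; the freedom in
    W is in its frozen-frozen entries. *)
Definition carries_form B f := exists W : 'I_n -> 'I_n -> int,
  [/\ forall i j, W i j = - W j i, forall k j, W (col k) j = D k k * B k j
    & log_form iota f W = w0].

Definition seed_inv B f : Prop :=
  [/\ forall i, f i != 0, exists F, log_frame iota f F,
      forall i, i \notin codom col -> f i = x0 i & carries_form B f].

Lemma seed_inv_mutate k B f : seed_inv B f ->
  seed_inv (mutate_mx le_mn k B) (mutated (col k) (B k) f).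
Proof.
move=> [f0 [F frameF] f_frozen [W [W_anti W_row W_form]]].
have Bk := row_diag D_gt0 W_anti W_row k.
have p0 := frame_exch_poly_neq0 (B k) f0 frameF.
split.
- exact: mutated_neq0.
- by exists (mutated_frame (col k) (B k) f F); apply: log_frame_mutated.
- move=> i Fi; rewrite -f_frozen // /mutated; case: eqP => // ik.
  by rewrite ik codom_f in Fi.
exists (mutated_coef (col k) (B k) W (D k k)); split.
- exact: mutated_coef_anti.
- by move=> l j; apply: mutated_coef_row.
by rewrite -W_form; apply: log_form_mutated.
Qed.

(** If row k of B is nonzero at i, the scalar is the ratio of the entries at i.
    If it is zero, so is column k, by symmetrizability, and the scalar is 0. *)
Lemma invariant_rows k B f : seed_inv B f ->
  upper_form le_mn iota B f
  = upper_form le_mn iota (mutate_mx le_mn k B) (mutated (col k) (B k) f) ->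
  exists c : C, forall j,
    (antisym_ext le_mn B (col k) j)%:~R = iota c * (B k j)%:~R.
Proof.
move=> [f0 [F frameF] f_frozen [W [W_anti W_row W_form]]].
move/(congr1 (fun w => w *+ 2)); rewrite !upper_form_log_form => eq_form.
have Bk := row_diag D_gt0 W_anti W_row k.
have prop := mutation_invariant_proportional Bk f0 frameF
  (@antisym_ext_anti _ _ _ _) (@antisym_ext_anti _ _ _ _) eq_form.
have [/existsP[i Bi]|] := boolP [exists i, B k i != 0].
  have Bi0 : (B k i)%:~R != 0 :> K by rewrite (intr_K_eq0 iota).
  exists ((antisym_ext le_mn B (col k) i)%:~R / (B k i)%:~R) => j.
  rewrite fmorph_div !rmorph_int mulrAC; apply: (canRL (mulfK Bi0)).
  by rewrite -!rmorphM /= mulrC prop mulrC.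
rewrite negb_exists => /forallP B0; exists 0 => j; rewrite rmorph0 mul0r.
have {}B0 i : B k i = 0 by apply/eqP; have := B0 i; rewrite negbK.
rewrite /antisym_ext upper_part_col B0 if_same sub0r.
have [/codomP[l ->]|jF] := boolP (j \in codom col); last first.
  by rewrite upper_part_frozen // oppr0.
by rewrite upper_part_col (row_zero D_gt0 W_anti W_row) // if_same oppr0.
Qed.

End Invariant.

Variable gen : K -> Prop.
Local Notation alg := (in_alg_gen iota gen).
Local Notation reg := (regular_form2 (iota := iota) gen).

Lemma regular_half w : reg (w *+ 2) -> reg w.
Proof.
move=> rw; have -> : w = iota 2^-1 *: (w *+ 2).
  rewrite -scaler_nat scalerA -(rmorph_nat iota 2) -rmorphM mulVf.
    by rewrite rmorph1 scale1r.
  by rewrite pnatr_eq0.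
by apply: regularZ => //; apply: in_alg_scalar.
Qed.

Section Cluster.
Variables (B : 'M[int]_(m, n)) (f : 'I_n -> K).
Hypothesis alg_f : forall i, alg (f i).
Hypothesis alg_fV : forall i, i \notin codom col -> alg (f i)^-1.

(** The two forms differ by wedges of logarithmic differentials of frozen
    variables, and these are units of the algebra. *)
Lemma regular_same_rows (V W : 'I_n -> 'I_n -> int) :
  (forall i j, V i j = - V j i) -> (forall i j, W i j = - W j i) ->
  (forall k j, V (col k) j = W (col k) j) ->
  reg (log_form iota f W) -> reg (log_form iota f V).
Proof.
move=> V_anti W_anti VW regW.
have -> : log_form iota f V
    = log_form iota f W + log_form iota f (fun i j => V i j - W i j).
  rewrite /log_form -big_split; apply: eq_bigr => i _ /=.
  rewrite -big_split; apply: eq_bigr => j _ /=.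
  by rewrite -scalerDl -rmorphD addrC subrK.
apply: regularD => //; apply: regular_sum => i _; apply: regular_sum => j _.
have [/codomP[k ->]|iF] := boolP (i \in codom col).
  by rewrite VW subrr scale0r; apply: regular0.
have [/codomP[k ->]|jF] := boolP (j \in codom col).
  by rewrite V_anti W_anti VW subrr scale0r; apply: regular0.
rewrite wedge_dlog; apply: regularZ; first exact: in_alg_int.
apply: regularZ; last exact: regular_wedge.
by apply: in_algM; apply: alg_fV.
Qed.

Hypothesis f_neq0 : forall i, f i != 0.
Hypothesis alg_f' : forall k, alg (mutated (col k) (B k) f (col k)).
Hypothesis B_sign : forall k l, B k (col l) < 0 -> 0 < B l (col k).
Hypothesis B_acyclic : acyclic_mx le_mn B.

Lemma acyclic_log_form_regular (W : 'I_n -> 'I_n -> int) :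
  (forall i j, W i j = - W j i) ->
  (forall k, exists c : C, forall j, (W (col k) j)%:~R = iota c * (B k j)%:~R) ->
  reg (log_form iota f W).
Proof.
move=> W_anti W_row; apply: (log_form_regular (col := col) (B := B)
    (f' := fun k => mutated (col k) (B k) f (col k))) => //.
- exact: col_inj.
- by move=> k; rewrite /mutated eqxx mulrA divff // mul1r.
move=> k; have [c cP] := W_row k; exists (iota c) => //.
exact: in_alg_scalar.
Qed.

End Cluster.
End Seeds.

Section ClusterAlgebra.
Variables (C : numFieldType) (m n : nat) (le_mn : (m <= n)%N).
Variable (A : 'M[int]_(m, n)).
Local Notation col := (widen_ord le_mn).
Local Notation K := (ratfun n C).
Local Notation iota := (const_ratfun n C).
Local Notation alg := (in_alg_gen iota (cluster_gen le_mn A)).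
Implicit Type s : seed m n C.

Lemma exchange_monomial (f : 'I_n -> K) (b : 'I_n -> int) :
  \prod_(j | 0 < b j) f j ^+ `|b j| = mpos f b.
Proof.
rewrite big_mkcond; apply: eq_bigr => j _.
by case: (b j) => [[]|].
Qed.

Lemma mutateE s k : (mutate le_mn s k).1 = mutate_mx le_mn k s.1
  /\ (mutate le_mn s k).2 = mutated (col k) (s.1 k) s.2 :> ('I_n -> K).
Proof.
case: s => B f; split=> //; apply: funext => i; rewrite /= ffunE /mutated.
case: eqP => // ->; congr (_ * (_ + _)); first exact: exchange_monomial.
rewrite big_mkcond; apply: eq_bigr => j _.
by case: (B k j) => [[]|].
Qed.

Lemma seed_of_mutate s k : seed_of le_mn A s -> seed_of le_mn A (mutate le_mn s k).
Proof. by move=> [ks ->]; exists (rcons ks k); rewrite foldl_rcons. Qed.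

Lemma seed_alg s i : seed_of le_mn A s -> alg (s.2 i).
Proof. by move=> sA; apply: in_alg_mem; left; exists s => //; exists i. Qed.

Lemma seed_mutated_alg s k : seed_of le_mn A s ->
  alg (mutated (col k) (s.1 k) s.2 (col k)).
Proof.
move=> sA; have [_ <-] := mutateE s k.
exact/seed_alg/seed_of_mutate.
Qed.

Lemma seed_invariant D s : symmetrizer le_mn D A -> seed_of le_mn A s ->
  seed_inv le_mn D (@initial_cluster n C)
    (log_form iota (@initial_cluster n C) (antisym_ext le_mn (D *m A))) s.1 s.2.
Proof.
move=> DA; have [D_diag D_gt0 _] := DA; case=> ks ->.
elim/last_ind: ks => [|ks k IH]; last first.
  rewrite foldl_rcons; move: (foldl _ _ _) IH => t IH; have [-> ->] := mutateE t k.
  exact: seed_inv_mutate.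
have -> : ((initial_seed C A).2 : 'I_n -> K) = @initial_cluster n C.
  by apply: funext => i; rewrite ffunE.
split=> //; first exact: initial_cluster_neq0.
  by exists (@euler_frame n C); apply: initial_log_frame.
exists (antisym_ext le_mn (D *m A)); split=> // [i j|k j].
  exact: antisym_ext_anti.
by rewrite antisym_ext_col ?mul_diagE //; apply: symmetrizer_antisym.
Qed.

Lemma frozen_inverse_alg D s i : symmetrizer le_mn D A -> seed_of le_mn A s ->
  i \notin codom col -> alg (s.2 i)^-1.
Proof.
move=> DA sA iF; have [_ _ -> // _] := seed_invariant DA sA.
by apply: in_alg_mem; right; exists i; rewrite // -frozenE.
Qed.

Lemma acyclic_seed_regular D s (W : 'I_n -> 'I_n -> int) :
  symmetrizer le_mn D A -> seed_of le_mn A s -> acyclic_mx le_mn s.1 ->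
  (forall i j, W i j = - W j i) ->
  (forall k, exists c : C, forall j, (W (col k) j)%:~R = iota c * (s.1 k j)%:~R) ->
  regular_form2 (cluster_gen le_mn A) (log_form iota s.2 W).
Proof.
move=> DA sA s_acyclic W_anti W_row; have [_ D_gt0 _] := DA.
have [f0 _ _ [V [V_anti V_row _]]] := seed_invariant DA sA.
apply: acyclic_log_form_regular W_row => // [i|i|k|k l].
- exact: seed_alg.
- exact: frozen_inverse_alg DA sA.
- exact: seed_mutated_alg.
exact: row_sign D_gt0 V_anti V_row _ _.
Qed.

Lemma wp_form_scaled_regular D s0 s : symmetrizer le_mn D A ->
  seed_of le_mn A s0 -> acyclic_mx le_mn s0.1 -> seed_of le_mn A s ->
  regular_on le_mn A (wp_form le_mn (D *m s.1) s.2).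
Proof.
move=> DA s0A s0_acyclic sA; have [D_diag D_gt0 _] := DA.
have [_ _ _ [W0 [W0_anti W0_row W0_form]]] := seed_invariant DA s0A.
have [_ _ _ [W [W_anti W_row W_form]]] := seed_invariant DA sA.
rewrite /regular_on wp_formE; apply: regular_half.
rewrite upper_form_log_form.
have alg_f i : alg (s.2 i) by apply: seed_alg.
have alg_fV i : i \notin codom col -> alg (s.2 i)^-1.
  exact: frozen_inverse_alg DA sA.
have ext_anti := @antisym_ext_anti m n le_mn (D *m s.1).
apply: (regular_same_rows alg_f alg_fV ext_anti W_anti) => [k j|].
  exact: (antisym_ext_scaled W_anti W_row k j D_diag).
rewrite W_form -W0_form; apply: (acyclic_seed_regular DA s0A s0_acyclic W0_anti).
move=> k.
exact: (scaled_row_scalar W0_row).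
Qed.

Lemma weil_petersson_regular D s0 (w : rational_form2 n C) :
  symmetrizer le_mn D A -> seed_of le_mn A s0 -> acyclic_mx le_mn s0.1 ->
  weil_petersson le_mn A w -> regular_on le_mn A w.
Proof.
move=> DA s0A s0_acyclic wP; have [_ D_gt0 _] := DA.
rewrite (wP s0 s0A) /regular_on wp_formE; apply: regular_half.
rewrite upper_form_log_form; have ext_anti := @antisym_ext_anti m n le_mn s0.1.
apply: (acyclic_seed_regular DA s0A s0_acyclic ext_anti) => k.
apply: (invariant_rows D_gt0 (seed_invariant DA s0A)).
have [e1 e2] := mutateE s0 k; rewrite -e1 -e2.
rewrite -!wp_formE -(wP s0 s0A); apply: wP; exact: seed_of_mutate.
Qed.

End ClusterAlgebra.

Theorem theorem5p2p1 (R : realType) (m n : nat) (le_mn : (m <= n)%N)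
    (A : 'M[int]_(m, n)) :
  skew_symmetrizable le_mn A ->
  acyclic_cluster_algebra le_mn R[i] A ->
  (forall w : rational_form2 n R[i],
     weil_petersson le_mn A w -> regular_on le_mn A w)
  /\ (forall D : 'M[int]_m, symmetrizer le_mn D A ->
      forall s : seed m n R[i], seed_of le_mn A s ->
        regular_on le_mn A (wp_form le_mn (D *m s.1) s.2)).
Proof.
move=> [D0 D0A] [s0 s0A s0_acyclic]; split=> [w|D DA s sA].
  exact: weil_petersson_regular D0A s0A s0_acyclic.
exact: wp_form_scaled_regular DA s0A s0_acyclic sA.
Qed.
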